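(* Let $\mathsf{M}$ be a matroid with ground set $E(\mathsf{M})$. Then, as quantum permutation groups on $E(\mathsf{M})$, $$C(\operatorname{Aut}(\mathsf{M})) = \mathfrak{Aut}_{\mathcal{F}}(\mathsf{M}) \leq \mathfrak{Aut}_{\mathcal{B}}(\mathsf{M}) = \mathfrak{Aut}_{\mathcal{I}}(\mathsf{M}).$$ If moreover $\mathsf{M}$ is a simple matroid of rank $3$ such that $E(\mathsf{M}) \neq F_1\cup F_2\cup F_3$ for all triangles $\{F_1,F_2,F_3\}$ of $\mathsf{M}$, then $$C(\operatorname{Aut}(\mathsf{M})) = \mathfrak{Aut}_{\mathcal{F}}(\mathsf{M}) \leq \mathfrak{Aut}_{\mathcal{C}}(\mathsf{M}) \leq \mathfrak{Aut}_{\mathcal{B}}(\mathsf{M}) = \mathfrak{Aut}_{\mathcal{I}}(\mathsf{M}).$$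
   Context: Matroids have nonempty finite ground sets. A circuit of a matroid is a minimal dependent set; a loop is an element $x$ with $\{x\}$ dependent; a matroid is simple if it has no loops and no parallel elements. A flat is a set $F$ with $\operatorname{rank}(F\cup\{b\})>\operatorname{rank}(F)$ for all $b\notin F$. A triangle of a rank $3$ simple matroid is a triple $\{F_1,F_2,F_3\}$ of rank-$2$ flats that pairwise intersect but satisfy $F_1\cap F_2\cap F_3=\emptyset$. $\operatorname{Aut}(\mathsf{M})$ is the group of bijections $E(\mathsf{M})\to E(\mathsf{M})$ that map bases to bases and non-bases to non-bases. Quantum permutation groups. All ideals are two-sided. For a finite set $E$, $\mathbb{C}\langle E^2\rangle$ is the noncommutative polynomial ring over $\mathbb{C}$ in the variables $u_{ij}$, $i,j\in E$, with the conjugate-linear, anti-multiplicative involution determined by $u_{ij}^*=u_{ij}$. Let $I_E$ be the ideal generated by $u_{ij}^2-u_{ij}$; $u_{ik}u_{i\ell}$ and $u_{kj}u_{\ell j}$ for $k\ne\ell$; $\sum_{k\in E}u_{kj}-1$ and $\sum_{k\in E}u_{ik}-1$ (for all $i,j\in E$). The quantum symmetric group is $\mathfrak{S}_E=\mathbb{C}\langle E^2\rangle/I_E$ with coproduct $\Delta(u_{ij})=\sum_{k\in E}u_{ik}\otimes u_{kj}$. A quantum permutation group on $E$ is an involutive algebra $\mathfrak{G}=\mathbb{C}\langle E^2\rangle/I(\mathfrak{G})$, where $I(\mathfrak{G})\supseteq I_E$ is a self-adjoint ideal such that $\Delta$ induces a coproduct on $\mathfrak{G}$. One writes $\mathfrak{G}_1\le\mathfrak{G}_2$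 if $I(\mathfrak{G}_1)\supseteq I(\mathfrak{G}_2)$, and $\mathfrak{G}_1=\mathfrak{G}_2$ if $I(\mathfrak{G}_1)=I(\mathfrak{G}_2)$. For a subgroup $G$ of the symmetric group on $E$, the algebra $C(G)$ of complex functions on $G$ is viewed as the quantum permutation group on $E$ whose ideal consists of all $f\in\mathbb{C}\langle E^2\rangle$ that vanish under the substitution $u_{ij}\mapsto\sigma_{ij}$ for every $\sigma\in G$, where $\sigma_{ij}$ is the $(i,j)$-entry of the permutation matrix of $\sigma$ (equal to $1$ if $\sigma(i)=j$ and $0$ otherwise). Let $\operatorname{Tup}(E)$ be the set of tuples of elements of $E$ of length at most $|E|$. For tuples $A=(a_1,\dots,a_k)$, $B=(b_1,\dots,b_k)$ of the same length set $u_{AB}=u_{a_1b_1}\cdots u_{a_kb_k}$. For $\mathcal{A}\subseteq\operatorname{Tup}(E)$, let $\mathfrak{G}_{\mathcal{A}}$ be the quotient of $\mathfrak{S}_E$ by the ideal generated by all $u_{AB}$ with $A,B\in\operatorname{Tup}(E)$ of the same length and exactly one of $A,B$ in $\mathcal{A}$. For a rank-$r$ matroid $\mathsf{M}$ and $E=E(\mathsf{M})$, a tuple $A$ is: an independent tuple if it has no repeated elements and its underlying set is independent; a basis tuple if it is an independent tuple of length $r$; a flat tuple if it has no repeated elements and its underlying set is a flat; a circuit tuple if $A=(a,a)$ for a nonloop $a$, or $A$ has no repeated elements and its underlying set is a circuit. $\mathfrak{Aut}_{\mathcal{I}}(\mathsf{M})$, $\mathfrak{Aut}_{\mathcal{B}}(\mathsf{M})$,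 $\mathfrak{Aut}_{\mathcal{F}}(\mathsf{M})$, $\mathfrak{Aut}_{\mathcal{C}}(\mathsf{M})$ denote $\mathfrak{G}_{\mathcal{A}}$ with $\mathcal{A}$ the set of all independent, basis, flat, circuit tuples of $\mathsf{M}$ in $\operatorname{Tup}(E)$, respectively. *)

(* Defs.v *)
From HB Require Import structures.
From mathcomp Require Import all_boot all_order all_algebra all_fingroup.
From mathcomp Require Import reals complex finmap monalg.

Set Implicit Arguments.
Unset Strict Implicit.
Unset Printing Implicit Defensive.

Import Order.TTheory GRing.Theory Num.Theory.
Local Open Scope ring_scope.

Section Ideals.
Variable A : nzRingType.
Implicit Types (S I : A -> Prop) (f g a : A).

Record two_sided_ideal I : Prop := TwoSidedIdeal {
  ideal0 : I 0;
  idealD : forall f g, I f -> I g -> I (f + g);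
  idealMl : forall a f, I f -> I (a * f);
  idealMr : forall a f, I f -> I (f * a)
}.

Definition ideal_gen S f : Prop :=
  forall I, two_sided_ideal I -> (forall g, S g -> I g) -> I f.

Lemma ideal_gen_ideal S : two_sided_ideal (ideal_gen S).
Proof.
split.
- by move=> I idI _; apply: ideal0.
- by move=> f g hf hg I idI sI; apply: idealD => //; [apply: hf|apply: hg].
- by move=> a f hf I idI sI; apply: idealMl => //; apply: hf.
- by move=> a f hf I idI sI; apply: idealMr => //; apply: hf.
Qed.

Lemma ideal_gen_in S f : S f -> ideal_gen S f.
Proof. by move=> Sf I _; apply. Qed.

Lemma ideal_gen_sub S S' f :
  (forall g, S g -> S' g) -> ideal_gen S f -> ideal_gen S' f.
Proof. by move=> sub hf I idI sI; apply: hf => // g /sub; apply: sI. Qed.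

Section Theory.
Variables (I : A -> Prop) (idI : two_sided_ideal I).

Lemma idealN f : I f -> I (- f).
Proof. by move=> If; rewrite -mulN1r; apply: idealMl. Qed.

Lemma idealB f g : I f -> I g -> I (f - g).
Proof. by move=> If Ig; apply: idealD => //; apply: idealN. Qed.

Lemma ideal_sum (T : Type) (r : seq T) (P : pred T) (F : T -> A) :
  (forall i, P i -> I (F i)) -> I (\sum_(i <- r | P i) F i).
Proof.
by move=> IF; elim/big_rec: _ => [|i x Pi Ix]; [apply: ideal0|apply: idealD => //; apply: IF].
Qed.

Lemma ideal_sum_seq (T : eqType) (r : seq T) (F : T -> A) :
  (forall i, i \in r -> I (F i)) -> I (\sum_(i <- r) F i).
Proof. by move=> IF; rewrite big_seq; apply: ideal_sum. Qed.

Lemma ideal_trans f g h : I (f - g) -> I (g - h) -> I (f - h).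
Proof. by move=> h1 h2; rewrite -[f](subrK g) -addrA; apply: idealD. Qed.

Lemma ideal_subD f g h k : I (f - g) -> I (h - k) -> I (f + h - (g + k)).
Proof. by move=> h1 h2; rewrite opprD addrACA; apply: idealD. Qed.


(* If a matrix U with inverse V commutes modulo I with a diagonal 0/1 matrix,
   then so does V. *)
Lemma ideal_inv_comm (T : eqType) (r : seq T) (U V : T -> T -> A)
    (p : pred T) :
  uniq r ->
  (forall x y, x \in r -> y \in r -> p x != p y -> I (U x y)) ->
  (forall x y, x \in r -> y \in r ->
     I (\sum_(z <- r) U x z * V z y - (x == y)%:R)) ->
  (forall x y, x \in r -> y \in r ->
     I (\sum_(z <- r) V x z * U z y - (x == y)%:R)) ->
  forall x y, x \in r -> y \in r -> p x != p y -> I (V x y).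
Proof.
move=> ur IU UV VU b a rb ra pba; pose q x : A := (p x)%:R.
have qC x z : z * q x = q x * z by apply/commr_nat.
have h0 : I (\sum_(c <- r) \sum_(d <- r) V b c * q c * (U c d * V d a) -
             \sum_(c <- r) \sum_(d <- r) V b c * q d * (U c d * V d a)).
  rewrite -sumrB; apply: ideal_sum_seq => c rc.
  rewrite -sumrB; apply: ideal_sum_seq => d rd.
  rewrite -mulrBl -mulrBr; have [pcd|pcd] := eqVneq (p c) (p d).
    by rewrite /q pcd subrr mulr0 mul0r; apply: ideal0.
  by apply: idealMl => //; apply: idealMr => //; apply: IU.
have h1 : I (\sum_(c <- r) \sum_(d <- r) V b c * q c * (U c d * V d a) -
             V b a * q a).
  have -> : V b a * q a = \sum_(c <- r) V b c * q c * (c == a)%:R.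
    rewrite (bigD1_seq a) //= eqxx mulr1 big1 ?addr0 //.
    by move=> c /negPf->; rewrite mulr0.
  rewrite -sumrB; apply: ideal_sum_seq => c rc.
  by rewrite -mulr_sumr -mulrBr; apply: idealMl => //; apply: UV.
have h2 : I (\sum_(c <- r) \sum_(d <- r) V b c * q d * (U c d * V d a) -
             V b a * q b).
  rewrite exchange_big /=.
  have -> : V b a * q b = \sum_(d <- r) (b == d)%:R * (q d * V d a).
    rewrite (bigD1_seq b) //= eqxx mul1r qC big1 ?addr0 //.
    by move=> c; rewrite eq_sym => /negPf->; rewrite mul0r.
  rewrite -sumrB; apply: ideal_sum_seq => d rd.
  under eq_bigr => c _ do
    rewrite -mulrA [q d * _]mulrA -(qC d (U c d)) -[_ * _ * V d a]mulrA mulrA.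
  by rewrite -mulr_suml -mulrBl; apply: idealMr => //; apply: VU.
have : I (V b a * q a - V b a * q b).
  apply: ideal_trans (ideal_trans h0 h2).
  by have := idealN h1; rewrite opprB.
move: pba; rewrite /q; case: (p a); case: (p b) => //= _.
  by rewrite mulr1 mulr0 subr0.
by rewrite mulr1 mulr0 sub0r => /idealN; rewrite opprK.
Qed.

End Theory.
End Ideals.

Section MalgExtra.
Variables (K : choiceType) (V : zmodType).

Lemma malg_ind (P : {malg V[K]} -> Prop) :
  P 0 -> (forall f g, P f -> P g -> P (f + g)) ->
  (forall c m, P << c *g m >>) -> forall f, P f.
Proof.
move=> P0 PD PU f; rewrite [f]monalgE.
by elim/big_rec: _ => // m g _ Pg; apply: PD.
Qed.
End MalgExtra.

Lemma malgMUU (K : monomType) (S : nzRingType) (c d : S) (k l : K) :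
  << c *g k >> * << d *g l >> = << c * d *g mmul k l >> :> {malg S[K]}.
Proof. by rewrite malgM_def fgmulUU. Qed.

Lemma malgC_comm (K : monomType) (S : comNzRingType) (c : S) (f : {malg S[K]}) :
  GRing.comm c%:MP f.
Proof.
rewrite /GRing.comm; elim/malg_ind: f => [|f g IHf IHg|d m].
- by rewrite mulr0 mul0r.
- by rewrite mulrDr mulrDl IHf IHg.
- by rewrite !malgMUU mul1m mulm1 mulrC.
Qed.

(* C<E^2> is the monoid algebra of the free monoid on E * E; the field of
   complex numbers is R[i] for a model R of the real numbers. *)
Notation ncpoly R E := {malg R[i][{fmonom (E * E)%type}]}.

(* The monomials of C<E^2> (x) C<E^2> are the pairs of monomials. *)
Section ProdMonom.
Variables M N : monomType.

Definition pair_one : M * N := (mone, mone).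
Definition pair_mul (x y : M * N) : M * N := (mmul x.1 y.1, mmul x.2 y.2).

Lemma pair_mulA : associative pair_mul.
Proof. by move=> x y z; rewrite /pair_mul /= !mulmA. Qed.
Lemma pair_mul1m : left_id pair_one pair_mul.
Proof. by case=> x y; rewrite /pair_mul /= !mul1m. Qed.
Lemma pair_mulm1 : right_id pair_one pair_mul.
Proof. by case=> x y; rewrite /pair_mul /= !mulm1. Qed.
Lemma pair_unitm x y :
  pair_mul x y = pair_one -> x = pair_one /\ y = pair_one.
Proof.
by case: x y => [x1 x2] [y1 y2] [/unitm[-> ->] /unitm[-> ->]].
Qed.

HB.instance Definition _ := Choice_isMonomialDef.Build (M * N)%type
  pair_mulA pair_mul1m pair_mulm1 pair_unitm.
End ProdMonom.

Notation ncpoly2 R E :=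
  {malg R[i][({fmonom (E * E)%type} * {fmonom (E * E)%type})%type]}.

(* The operations below are locked because conversion would otherwise unfold
   the arithmetic of the monoid algebra. *)
HB.lock Definition uvar (R : realType) (E : finType) (i j : E) : ncpoly R E :=
  << FMonom [:: (i, j)] >>.
Arguments uvar {R E} i j.

(* The conjugate-linear anti-multiplicative involution fixing each u_ij. *)
HB.lock Definition nc_star (R : realType) (E : finType) (f : ncpoly R E) :
    ncpoly R E :=
  mmap (malgC \o Num.conj)
    (fun m : {fmonom (E * E)%type} => << FMonom (rev m) >>) f.
Arguments nc_star {R E} f.

(* The elementary tensor f (x) g. *)
HB.lock Definition tens (R : realType) (E : finType) (f g : ncpoly R E) :
    ncpoly2 R E :=
  \sum_(m <- msupp f) \sum_(n <- msupp g) << f@_m * g@_n *g (m, n) >>.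
Arguments tens {R E} f g.

Definition fm_subst (E : finType) (S : nzRingType) (x : E -> E -> S)
    (m : {fmonom (E * E)%type}) : S :=
  \prod_(p <- (m : seq (E * E))) x p.1 p.2.

HB.lock Definition comult (R : realType) (E : finType) (f : ncpoly R E) :
    ncpoly2 R E :=
  mmap malgC
    (fm_subst (fun i j => \sum_(k : E) tens (uvar i k) (uvar k j))) f.
Arguments comult {R E} f.

(* The substitution of the (i, j)-entry of the permutation matrix of s for
   u_ij. *)
HB.lock Definition perm_eval (R : realType) (E : finType) (s : {perm E})
    (f : ncpoly R E) : R[i] :=
  mmap idfun (fm_subst (fun i j => (s i == j)%:R)) f.
Arguments perm_eval {R E} s f.

Section FreeAlgebra.
Variables (R : realType) (E : finType).
Local Notation F := (ncpoly R E).
Local Notation F2 := (ncpoly2 R E).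
Implicit Types (f g : F) (i j k l : E) (m : {fmonom (E * E)%type}).

Variant magic_rel : F -> Prop :=
| MagicIdem i j : magic_rel (uvar i j * uvar i j - uvar i j)
| MagicRow i k l : k != l -> magic_rel (uvar i k * uvar i l)
| MagicCol j k l : k != l -> magic_rel (uvar k j * uvar l j)
| MagicColSum j : magic_rel (\sum_(k : E) uvar k j - 1)
| MagicRowSum i : magic_rel (\sum_(k : E) uvar i k - 1).

(* With F = C<E^2>, the coproduct of F induces one on F/I iff it maps I into
   the kernel of F (x) F -> F/I (x) F/I, and this kernel is
   I (x) F + F (x) I, i.e. the ideal generated by I (x) 1 and 1 (x) I. *)
Variant tens_rel (I : F -> Prop) : F2 -> Prop :=
| TensL f : I f -> tens_rel I (tens f 1)
| TensR f : I f -> tens_rel I (tens 1 f).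

Definition tens_ideal (I : F -> Prop) : F2 -> Prop := ideal_gen (tens_rel I).

(* A quantum permutation group C<E^2>/I is represented by its ideal I; inclusion
   and equality compare these ideals. *)
Record qpermgroup := QPermGroup {
  qideal : F -> Prop;
  qideal_ideal : two_sided_ideal qideal;
  qideal_magic : forall f, ideal_gen magic_rel f -> qideal f;
  qideal_star : forall f, qideal f -> qideal (nc_star f);
  qideal_comult : forall f, qideal f -> tens_ideal qideal (comult f)
}.

Definition qperm_le (G1 G2 : qpermgroup) : Prop :=
  forall f, qideal G2 f -> qideal G1 f.

Definition qperm_eq (G1 G2 : qpermgroup) : Prop :=
  forall f, qideal G1 f <-> qideal G2 f.

Definition uprod (A B : seq E) : F := \prod_(p <- zip A B) uvar p.1 p.2.

Definition in_Tup (A : seq E) : bool := (size A <= #|E|)%N.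

Variant tuple_rel (T : pred (seq E)) : F -> Prop :=
| TupleMagic f : magic_rel f -> tuple_rel T f
| TupleSep A B : in_Tup A -> in_Tup B -> size A = size B ->
    T A != T B -> tuple_rel T (uprod A B).

Definition tuple_ideal (T : pred (seq E)) : F -> Prop :=
  ideal_gen (tuple_rel T).

Definition perm_ideal (G : {group {perm E}}) : F -> Prop :=
  fun f => forall s, s \in G -> perm_eval s f = 0.

Fact fm_subst_morph (S : nzRingType) (x : E -> E -> S) :
  mmorphism (@fm_subst E S x).
Proof.
rewrite /fm_subst; split; last by rewrite fm1 big_nil.
by move=> m n; rewrite fmM big_cat.
Qed.
HB.instance Definition _ (S : nzRingType) (x : E -> E -> S) :=
  isMultiplicative.Build {fmonom (E * E)%type} S (fm_subst x)
    (fm_subst_morph x).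

Lemma uvarE i j : uvar i j = << FMonom [:: (i, j)] >> :> F.
Proof. by rewrite uvar.unlock. Qed.
Lemma comultD f g : comult (f + g) = comult f + comult g.
Proof. rewrite unlock; exact: mmapD. Qed.
Lemma comultN f : comult (- f) = - comult f.
Proof. rewrite unlock; exact: mmapN. Qed.
Lemma comult0 : comult (0 : F) = 0.
Proof. rewrite unlock; exact: mmap0. Qed.

Lemma comultM f g : comult (f * g) = comult f * comult g.
Proof.
rewrite unlock; apply: (commr_mmap_is_multiplicative _).1 => h m m'.
exact: malgC_comm.
Qed.
Lemma comult1 : comult (1 : F) = 1.
Proof. rewrite unlock; exact: mmap1. Qed.
Lemma comult_sum (T : Type) (r : seq T) (P : pred T) (G : T -> F) :
  comult (\sum_(i <- r | P i) G i) = \sum_(i <- r | P i) comult (G i).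
Proof. exact: (big_morph comult comultD comult0). Qed.
Lemma comult_uvar i j : comult (uvar i j : F) = \sum_k tens (uvar i k) (uvar k j).
Proof. by rewrite (uvarE i j) comult.unlock mmapU mul1r /fm_subst big_seq1. Qed.

Section PermEval.
Variable s : {perm E}.
Lemma perm_evalD f g : perm_eval s (f + g) = perm_eval s f + perm_eval s g.
Proof. rewrite unlock; exact: mmapD. Qed.
Lemma perm_evalB f g : perm_eval s (f - g) = perm_eval s f - perm_eval s g.
Proof. rewrite unlock; exact: mmapB. Qed.
Lemma perm_eval0 : perm_eval s (0 : F) = 0.
Proof. rewrite unlock; exact: mmap0. Qed.
Lemma perm_evalM f g : perm_eval s (f * g) = perm_eval s f * perm_eval s g.
Proof. rewrite unlock; exact: (mmap_is_multiplicative (f := idfun)).1. Qed.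
Lemma perm_eval1 : perm_eval s (1 : F) = 1.
Proof. rewrite unlock; exact: (mmap1 (f := idfun)). Qed.
Lemma perm_eval_sum (T : Type) (r : seq T) (P : pred T) (G : T -> F) :
  perm_eval s (\sum_(i <- r | P i) G i) =
  \sum_(i <- r | P i) perm_eval s (G i).
Proof. exact: (big_morph _ perm_evalD perm_eval0). Qed.
Lemma perm_eval_prod (T : Type) (r : seq T) (P : pred T) (G : T -> F) :
  perm_eval s (\prod_(i <- r | P i) G i) =
  \prod_(i <- r | P i) perm_eval s (G i).
Proof. exact: (big_morph _ perm_evalM perm_eval1). Qed.
Lemma perm_evalU c m : perm_eval s (<< c *g m >> : F) =
  c * fm_subst (fun i j => (s i == j)%:R) m.
Proof. rewrite unlock; exact: (mmapU (f := idfun)). Qed.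
Lemma perm_eval_uvar i j : perm_eval s (uvar i j : F) = (s i == j)%:R.
Proof.
by rewrite uvarE perm_evalU mul1r /fm_subst big_seq1.
Qed.
Lemma perm_evalC c : perm_eval s (c%:MP : F) = c.
Proof. rewrite unlock; exact: (mmapC (f := idfun)). Qed.
End PermEval.

Lemma nc_starD f g : nc_star (f + g) = nc_star f + nc_star g.
Proof. rewrite unlock; exact: mmapD. Qed.
Lemma nc_starB f g : nc_star (f - g) = nc_star f - nc_star g.
Proof. rewrite unlock; exact: mmapB. Qed.
Lemma nc_star0 : nc_star (0 : F) = 0.
Proof. rewrite unlock; exact: mmap0. Qed.
Lemma nc_starU c m : nc_star (<< c *g m >> : F) = << (c^*)%R *g FMonom (rev m) >>.
Proof. by rewrite nc_star.unlock mmapU /= malgMUU mulr1 mul1m. Qed.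
Lemma nc_star1 : nc_star (1 : F) = 1.
Proof.
rewrite [1 in LHS]/GRing.one /= /fgone nc_starU conjC1; congr << _ *g _ >>.
by rewrite fm1 -fmoneE.
Qed.
Lemma nc_starM f g : nc_star (f * g) = nc_star g * nc_star f.
Proof.
elim/malg_ind: f => [|f1 f2 IH1 IH2|c m].
- by rewrite mul0r nc_star0 mulr0.
- rewrite mulrDl.
  rewrite (nc_starD f1).
  rewrite (nc_starD (f1 * g)).
  rewrite [RHS]mulrDr.
  congr (_ + _).
    exact IH1.
  exact IH2.
elim/malg_ind: g => [|g1 g2 IH1 IH2|d n].
- by rewrite mulr0 nc_star0 mul0r.
- rewrite mulrDr (nc_starD g1) (nc_starD (_ * g1)) [RHS]mulrDl.
  congr (_ + _).
    exact IH1.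
  exact IH2.
rewrite malgMUU !nc_starU malgMUU rmorphM mulrC; congr << _ *g _ >>.
by rewrite fmM rev_cat [RHS]fmmulE.
Qed.
Lemma nc_star_uvar i j : nc_star (uvar i j : F) = uvar i j.
Proof. by rewrite uvarE nc_starU conjC1. Qed.
Lemma nc_star_sum (T : Type) (r : seq T) (P : pred T) (G : T -> F) :
  nc_star (\sum_(i <- r | P i) G i) = \sum_(i <- r | P i) nc_star (G i).
Proof. exact: (big_morph _ nc_starD nc_star0). Qed.
Lemma nc_starK f : nc_star (nc_star f) = f.
Proof.
elim/malg_ind: f => [|f1 f2 IH1 IH2|c m].
- by rewrite !nc_star0.
- rewrite (nc_starD f1) (nc_starD (nc_star f1)).
  by congr (_ + _); [exact IH1|exact IH2].
by rewrite !nc_starU conjCK /= revK fmK.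
Qed.

Lemma tensE f g x : (tens f g)@_x = f@_x.1 * g@_x.2.
Proof.
case: x => m0 n0 /=.
rewrite tens.unlock raddf_sum /=.
have inner m : (\sum_(n <- msupp g) << f@_m * g@_n *g (m, n) >>)@_(m0, n0)
   = (f@_m * g@_n0) *+ (m == m0).
  rewrite raddf_sum /= [in RHS](monalgE g) raddf_sum /= mulr_sumr -sumrMnl.
  apply: eq_bigr => n _; rewrite !mcoeffU xpair_eqE.
  by case: (m == m0); case: (n == n0); rewrite /= ?mulr0n ?mulr1n ?mulr0.
under eq_bigr do rewrite inner.
rewrite [in RHS](monalgE f) raddf_sum /= mulr_suml.
apply: eq_bigr => m _; rewrite mcoeffU.
by case: (m == m0); rewrite /= ?mulr0n ?mulr1n ?mul0r.
Qed.
Lemma tensUU c d m n :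
  tens (<< c *g m >> : F) << d *g n >> = << c * d *g (m, n) >>.
Proof.
apply/malgP => -[m0 n0]; rewrite tensE /= !mcoeffU xpair_eqE.
by case: (m == m0); case: (n == n0); rewrite /= ?mulr0n ?mulr1n ?mulr0 ?mul0r.
Qed.
Lemma tensDl f g h : tens (f + g) h = tens f h + tens g h.
Proof.
apply/malgP => x.
by rewrite [RHS]mcoeffD (tensE f) (tensE g) tensE (mcoeffD _ f) mulrDl.
Qed.
Lemma tensDr h f g : tens h (f + g) = tens h f + tens h g.
Proof.
apply/malgP => x.
by rewrite [RHS]mcoeffD (tensE _ f) (tensE _ g) tensE (mcoeffD _ f) mulrDr.
Qed.
Lemma tensBl f g h : tens (f - g) h = tens f h - tens g h.
Proof.
apply/malgP => x.
by rewrite [RHS]mcoeffB (tensE f) (tensE g) tensE (mcoeffB _ f) mulrBl.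
Qed.
Lemma tensBr h f g : tens h (f - g) = tens h f - tens h g.
Proof.
apply/malgP => x.
by rewrite [RHS]mcoeffB (tensE _ f) (tensE _ g) tensE (mcoeffB _ f) mulrBr.
Qed.
Lemma tens0l f : tens (0 : F) f = 0.
Proof. by apply/malgP => x; rewrite tensE !mcoeff0 mul0r. Qed.
Lemma tens0r f : tens f 0 = 0.
Proof. by apply/malgP => x; rewrite tensE !mcoeff0 mulr0. Qed.
Lemma tens_suml (T : Type) (r : seq T) (P : pred T) (G : T -> F) h :
  tens (\sum_(i <- r | P i) G i) h = \sum_(i <- r | P i) tens (G i) h.
Proof.
exact: (big_morph (tens^~ h) (fun f g => tensDl f g h) (tens0l h)).
Qed.
Lemma tens_sumr (T : Type) (r : seq T) (P : pred T) (G : T -> F) h :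
  tens h (\sum_(i <- r | P i) G i) = \sum_(i <- r | P i) tens h (G i).
Proof. exact: (big_morph (tens h) (tensDr h) (tens0r h)). Qed.
Lemma tens11 : tens (1 : F) 1 = 1.
Proof. by rewrite tensUU mulr1. Qed.
Lemma tensM f g f' g' : tens f g * tens f' g' = tens (f * f') (g * g').
Proof.
elim/malg_ind: f => [|f1 f2 IH1 IH2|c m].
- by rewrite tens0l !mul0r tens0l.
- rewrite (tensDl f1) [LHS]mulrDl (mulrDl f1) (tensDl (f1 * f')).
  by congr (_ + _); [exact IH1|exact IH2].
elim/malg_ind: g => [|f1 f2 IH1 IH2|d n].
- by rewrite tens0r !mul0r tens0r.
- rewrite (tensDr _ f1) [LHS]mulrDl (mulrDl f1) (tensDr _ (f1 * g')).
  by congr (_ + _); [exact IH1|exact IH2].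
elim/malg_ind: f' => [|f1 f2 IH1 IH2|c' m'].
- by rewrite tens0l !mulr0 tens0l.
- rewrite (tensDl f1) [LHS]mulrDr (mulrDr _ f1) (tensDl (_ * f1)).
  by congr (_ + _); [exact IH1|exact IH2].
elim/malg_ind: g' => [|f1 f2 IH1 IH2|d' n'].
- by rewrite tens0r !mulr0 tens0r.
- rewrite (tensDr _ f1) [LHS]mulrDr (mulrDr _ f1) (tensDr _ (_ * f1)).
  by congr (_ + _); [exact IH1|exact IH2].
by rewrite !tensUU !malgMUU tensUU mulrACA.
Qed.

Section TensIdeal.
Variables (I : F -> Prop).
Let idK : two_sided_ideal (tens_ideal I) := ideal_gen_ideal (tens_rel I).

Lemma tens_idealL f g : I f -> tens_ideal I (tens f g).
Proof.
move=> If; have -> : tens f g = tens f 1 * tens 1 g by rewrite tensM mulr1 mul1r.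
by apply: (idealMr idK) => //; apply: ideal_gen_in; constructor.
Qed.
Lemma tens_idealR f g : I g -> tens_ideal I (tens f g).
Proof.
move=> Ig; have -> : tens f g = tens f 1 * tens 1 g by rewrite tensM mulr1 mul1r.
by apply: (idealMl idK) => //; apply: ideal_gen_in; constructor.
Qed.

Lemma comult_ideal_gen S f :
  (forall g, S g -> tens_ideal I (comult g)) -> ideal_gen S f ->
  tens_ideal I (comult f).
Proof.
move=> hS /(_ (fun h => tens_ideal I (comult h))); apply=> //; split => [|a b ha hb|a b hb|a b hb].
- by rewrite comult0; apply: (ideal0 idK).
- by rewrite comultD; apply: (idealD idK).
- by rewrite comultM; apply: (idealMl idK).
- by rewrite comultM; apply: (idealMr idK).
Qed.

Lemma comult_uvarM i j k l : comult (uvar i j * uvar k l : F) =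
  \sum_p \sum_q tens (uvar i p * uvar k q) (uvar p j * uvar q l).
Proof.
rewrite comultM !comult_uvar mulr_suml; apply: eq_bigr => p _.
by rewrite mulr_sumr; apply: eq_bigr => q _; rewrite tensM.
Qed.

Lemma comult_magic f : two_sided_ideal I -> (forall g, magic_rel g -> I g) ->
  magic_rel f -> tens_ideal I (comult f).
Proof.
move=> idI hI; case=> [i j|i k l kl|j k l kl|j|i].
- rewrite comultD comultN comult_uvarM comult_uvar -sumrB.
  apply: (ideal_sum idK) => // p _; rewrite (bigD1 p) //= addrAC.
  apply: (idealD idK) => //; last first.
    apply: (ideal_sum idK) => // q qp; apply: tens_idealL; apply: hI.
    by apply: MagicRow; rewrite eq_sym.
  rewrite -(subrK (tens (uvar i p) (uvar p j * uvar p j))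
             (tens (uvar i p * uvar i p) _)) -addrA -tensBl -tensBr.
  by apply: (idealD idK) => //; [apply: tens_idealL|apply: tens_idealR];
    apply: hI; apply: MagicIdem.
- rewrite comult_uvarM; apply: (ideal_sum idK) => // p _; apply: (ideal_sum idK) => // q _.
  have [->|pq] := eqVneq p q.
    by apply: tens_idealR; apply: hI; apply: MagicRow.
  by apply: tens_idealL; apply: hI; apply: MagicRow.
- rewrite comult_uvarM; apply: (ideal_sum idK) => // p _; apply: (ideal_sum idK) => // q _.
  have [->|pq] := eqVneq p q.
    by apply: tens_idealL; apply: hI; apply: MagicCol.
  by apply: tens_idealR; apply: hI; apply: MagicCol.
- rewrite comultD comultN comult1 comult_sum.
  under eq_bigr do rewrite comult_uvar.
  rewrite exchange_big /=; under eq_bigr do rewrite -tens_suml.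
  rewrite -(subrK (tens 1 (\sum_p uvar p j)) (\sum_p _)) -addrA.
  apply: (idealD idK) => //.
    rewrite tens_sumr -sumrB; apply: (ideal_sum idK) => // p _; rewrite -tensBl.
    by apply: tens_idealL; apply: hI; apply: MagicColSum.
  by rewrite -tens11 -tensBr; apply: tens_idealR; apply: hI; apply: MagicColSum.
- rewrite comultD comultN comult1 comult_sum.
  under eq_bigr do rewrite comult_uvar.
  rewrite exchange_big /=; under eq_bigr do rewrite -tens_sumr.
  rewrite -(subrK (tens (\sum_p uvar i p) 1) (\sum_p _)) -addrA.
  apply: (idealD idK) => //.
    rewrite tens_suml -sumrB; apply: (ideal_sum idK) => // p _; rewrite -tensBr.
    by apply: tens_idealR; apply: hI; apply: MagicRowSum.
  by rewrite -tens11 -tensBl; apply: tens_idealL; apply: hI; apply: MagicRowSum.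
Qed.
End TensIdeal.


Lemma nc_star_ideal_gen (J : F -> Prop) S f : two_sided_ideal J ->
  (forall g, S g -> J (nc_star g)) -> ideal_gen S f -> J (nc_star f).
Proof.
move=> idJ hS /(_ (fun h => J (nc_star h))); apply=> //.
split => [|a b ha hb|a b hb|a b hb].
- by rewrite nc_star0; apply: (ideal0 idJ).
- by rewrite nc_starD; apply: (idealD idJ).
- by rewrite nc_starM; apply: (idealMr idJ).
- by rewrite nc_starM; apply: (idealMl idJ).
Qed.

Lemma nc_star_magic f : magic_rel f -> magic_rel (nc_star f).
Proof.
case=> [i j|i k l kl|j k l kl|j|i].
- by rewrite nc_starB nc_starM !nc_star_uvar; apply: MagicIdem.
- by rewrite nc_starM !nc_star_uvar; apply: MagicRow; rewrite eq_sym.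
- by rewrite nc_starM !nc_star_uvar; apply: MagicCol; rewrite eq_sym.
- rewrite nc_starB nc_star1 nc_star_sum.
  by under eq_bigr do rewrite nc_star_uvar; apply: MagicColSum.
- rewrite nc_starB nc_star1 nc_star_sum.
  by under eq_bigr do rewrite nc_star_uvar; apply: MagicRowSum.
Qed.

Lemma uprod_nil : uprod [::] [::] = 1.
Proof. by rewrite /uprod big_nil. Qed.
Lemma uprod_cons a b A B : uprod (a :: A) (b :: B) = uvar a b * uprod A B.
Proof. by rewrite /uprod big_cons. Qed.

Fixpoint words (k : nat) : seq (seq E) :=
  if k is k'.+1 then [seq x :: w | x <- enum E, w <- words k'] else [:: [::]].

Lemma mem_words A (k : nat) : (A \in words k) = (size A == k).
Proof.
elim: k A => [|k IH] [|a A] //=.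
  by apply/negP => /allpairsP[[x w] [_ _]].
apply/allpairsP/idP => [[[x w] [_ /= wk [_ ->]]]|].
  by rewrite eqSS -IH.
by rewrite eqSS -IH => Ak; exists (a, A); split; rewrite ?mem_enum.
Qed.

Lemma words_uniq (k : nat) : uniq (words k).
Proof.
elim: k => [|k IH] //=; apply: allpairs_uniq => //; first exact: enum_uniq.
by move=> [x w] [y v] _ _ /= [-> ->].
Qed.

Lemma big_words (V : zmodType) (k : nat) (G : seq E -> V) :
  \sum_(w <- words k.+1) G w = \sum_x \sum_(w <- words k) G (x :: w).
Proof. by rewrite big_allpairs_dep /= big_enum. Qed.

Lemma comult_uprod A B : size A = size B ->
  comult (uprod A B) = \sum_(C <- words (size A)) tens (uprod A C) (uprod C B).
Proof.
elim: A B => [|a A IH] [|b B] //=.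
  by rewrite uprod_nil comult1 big_seq1 uprod_nil tens11.
move=> [sAB]; rewrite uprod_cons comultM IH // comult_uvar big_words mulr_suml.
apply: eq_bigr => x _; rewrite mulr_sumr; apply: eq_bigr => w _.
by rewrite tensM !uprod_cons.
Qed.

Section MagicIdeal.
Variables (J : F -> Prop) (idJ : two_sided_ideal J).
Hypothesis magicJ : forall g, magic_rel g -> J g.

Lemma row_orth a c : J (\sum_b uvar a b * uvar c b - (a == c)%:R).
Proof.
have [<-|ac] := eqVneq a c; last first.
  rewrite subr0; apply: (ideal_sum idJ) => b _.
  by apply: magicJ; apply: MagicCol.
apply: (ideal_trans idJ (g := \sum_b uvar a b)); last first.
  by apply: magicJ; apply: MagicRowSum.
rewrite -sumrB; apply: (ideal_sum idJ) => b _.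
by apply: magicJ; apply: MagicIdem.
Qed.

Lemma col_orth b c : J (\sum_a uvar a b * uvar a c - (b == c)%:R).
Proof.
have [<-|bc] := eqVneq b c; last first.
  rewrite subr0; apply: (ideal_sum idJ) => a _.
  by apply: magicJ; apply: MagicRow.
apply: (ideal_trans idJ (g := \sum_a uvar a b)); last first.
  by apply: magicJ; apply: MagicColSum.
rewrite -sumrB; apply: (ideal_sum idJ) => a _.
by apply: magicJ; apply: MagicIdem.
Qed.

Lemma uprod_row_orth (k : nat) A C : size A = k -> size C = k ->
  J (\sum_(B <- words k) uprod A B * nc_star (uprod C B) - (A == C)%:R).
Proof.
elim: k A C => [|k IH] [|a A] [|c C] //=.
  move=> _ _; rewrite big_seq1 uprod_nil nc_star1 mulr1 subrr.
  exact: (ideal0 idJ).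
move=> [sA] [sC]; rewrite big_words.
apply: (ideal_trans idJ
  (g := \sum_b uvar a b * (A == C)%:R * uvar c b)).
  rewrite -sumrB; apply: (ideal_sum idJ) => b _.
  under eq_bigr => w _ do
    rewrite !uprod_cons nc_starM nc_star_uvar -mulrA [uprod A w * _]mulrA
      mulrA.
  rewrite -mulr_suml -mulr_sumr -mulrBl -mulrBr.
  by apply: (idealMr idJ); apply: (idealMl idJ); apply: IH.
rewrite eqseq_cons; case: (A == C); last first.
  rewrite andbF subr0; apply: (ideal_sum idJ) => b _.
  by rewrite mulr0 mul0r; apply: (ideal0 idJ).
by rewrite andbT; under eq_bigr do rewrite mulr1; apply: row_orth.
Qed.

Lemma uprod_col_orth (k : nat) B C : size B = k -> size C = k ->
  J (\sum_(A <- words k) nc_star (uprod A B) * uprod A C - (B == C)%:R).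
Proof.
elim: k B C => [|k IH] [|b B] [|c C] //=.
  move=> _ _; rewrite big_seq1 uprod_nil nc_star1 mulr1 subrr.
  exact: (ideal0 idJ).
move=> [sB] [sC]; rewrite big_words exchange_big /=.
apply: (ideal_trans idJ
  (g := \sum_(w <- words k) nc_star (uprod w B) * (b == c)%:R * uprod w C)).
  rewrite -sumrB; apply: (ideal_sum idJ) => w _.
  under eq_bigr => a _ do
    rewrite !uprod_cons nc_starM nc_star_uvar -mulrA [uvar a b * _]mulrA
      mulrA.
  rewrite -mulr_suml -mulr_sumr -mulrBl -mulrBr.
  by apply: (idealMr idJ); apply: (idealMl idJ); apply: col_orth.
rewrite eqseq_cons; case: (b == c); last first.
  rewrite subr0; apply: (ideal_sum idJ) => w _.
  by rewrite mulr0 mul0r; apply: (ideal0 idJ).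
by under eq_bigr do rewrite mulr1; apply: IH.
Qed.
End MagicIdeal.

Section TupleIdeal.
Variable T : pred (seq E).
Let J := tuple_ideal T.

Fact tuple_ideal_ideal : two_sided_ideal (tuple_ideal T).
Proof. exact: ideal_gen_ideal. Qed.
Let idJ : two_sided_ideal J := tuple_ideal_ideal.

Let magicJ g : magic_rel g -> J g.
Proof. by move=> mg; apply: ideal_gen_in; constructor. Qed.

Fact tuple_ideal_magic f : ideal_gen magic_rel f -> tuple_ideal T f.
Proof. by apply: ideal_gen_sub => g; constructor. Qed.

(* The matrix (u_AB) is unitary, so its adjoint also commutes with the
   diagonal projection onto the span of T. *)
Lemma nc_star_uprod A B : in_Tup A -> in_Tup B -> size A = size B ->
  T A != T B -> J (nc_star (uprod A B)).
Proof.
move=> tA tB sAB TAB.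
apply: (ideal_inv_comm idJ (r := words (size A)) (U := @uprod)
  (V := fun X Y => nc_star (uprod Y X)) (p := T)) => //.
- exact: words_uniq.
- move=> C D; rewrite !mem_words => /eqP sC /eqP sD TCD.
  by apply: ideal_gen_in; apply: TupleSep; rewrite /in_Tup ?sC ?sD.
- move=> C D; rewrite !mem_words => /eqP sC /eqP sD.
  exact: (uprod_row_orth idJ magicJ).
- move=> C D; rewrite !mem_words => /eqP sC /eqP sD.
  exact: (uprod_col_orth idJ magicJ).
- by rewrite mem_words sAB.
- by rewrite mem_words.
- by rewrite eq_sym.
Qed.

Fact tuple_ideal_star f : tuple_ideal T f -> tuple_ideal T (nc_star f).
Proof.
apply: nc_star_ideal_gen => // g [h /nc_star_magic mh|A B tA tB sAB TAB].
  exact: magicJ.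
exact: nc_star_uprod.
Qed.

Fact tuple_ideal_comult f :
  tuple_ideal T f -> tens_ideal (tuple_ideal T) (comult f).
Proof.
apply: comult_ideal_gen => g [h mh|A B tA tB sAB TAB].
  exact: comult_magic.
rewrite comult_uprod //.
apply: (ideal_sum_seq (ideal_gen_ideal _)) => C; rewrite mem_words => /eqP sC.
have tC : in_Tup C by rewrite /in_Tup sC.
have [TAC|TAC] := eqVneq (T A) (T C).
  apply: tens_idealR; apply: ideal_gen_in; apply: TupleSep => //.
    by rewrite sC.
  by rewrite -TAC.
by apply: tens_idealL; apply: ideal_gen_in; apply: TupleSep.
Qed.

(* The quantum permutation group G_T of a set T of tuples. *)
Definition qperm_tuples : qpermgroup :=
  QPermGroup tuple_ideal_ideal tuple_ideal_magic tuple_ideal_star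
    tuple_ideal_comult.
End TupleIdeal.

Section PermIdeal.
Variable G : {group {perm E}}.
Local Notation J := (perm_ideal G).

Fact perm_ideal_ideal : two_sided_ideal J.
Proof.
split=> [s _|f g Jf Jg s sG|a f Jf s sG|a f Jf s sG].
- exact: perm_eval0.
- by rewrite perm_evalD Jf // Jg // addr0.
- by rewrite perm_evalM Jf // mulr0.
- by rewrite perm_evalM Jf // mul0r.
Qed.

Fact perm_ideal_magic f : ideal_gen magic_rel f -> J f.
Proof.
apply; first exact: perm_ideal_ideal.
move=> _ [i j|i k l kl|j k l kl|j|i] s sG.
- rewrite perm_evalB perm_evalM !perm_eval_uvar.
  by case: (s i == j); rewrite ?mulr1 ?mulr0 subrr.
- rewrite perm_evalM !perm_eval_uvar.
  by have [->|_] := eqVneq (s i) k; rewrite ?mul0r // (negPf kl) mulr0.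
- rewrite perm_evalM !perm_eval_uvar.
  have [<-|_] := eqVneq (s k) j; rewrite ?mul0r // (inj_eq perm_inj).
  by rewrite eq_sym (negPf kl) mulr0.
- rewrite perm_evalB perm_eval1 perm_eval_sum.
  under eq_bigr do rewrite perm_eval_uvar.
  rewrite (bigD1 ((s^-1)%g j)) //= permKV eqxx big1 ?addr0 ?subrr // => k.
  by apply: contraNeq; rewrite pnatr_eq0 eqb0 negbK => /eqP <-; rewrite permK.
- rewrite perm_evalB perm_eval1 perm_eval_sum.
  under eq_bigr do rewrite perm_eval_uvar.
  rewrite (bigD1 (s i)) //= eqxx big1 ?addr0 ?subrr // => k.
  by rewrite eq_sym => /negPf->.
Qed.

Lemma perm_eval_star s f : perm_eval s (nc_star f) = ((perm_eval s f)^*)%R.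
Proof.
elim/malg_ind: f => [|f g IHf IHg|c m].
- by rewrite nc_star0 perm_eval0 conjC0.
- by rewrite (nc_starD f) (perm_evalD s f) perm_evalD IHf IHg rmorphD.
rewrite nc_starU !perm_evalU rmorphM; congr (_ * _).
rewrite /fm_subst /= big_rev /= rmorph_prod; apply: eq_bigr => p _.
by rewrite rmorph_nat.
Qed.

Fact perm_ideal_star f : J f -> J (nc_star f).
Proof. by move=> Jf s sG; rewrite perm_eval_star Jf // conjC0. Qed.

Let e (s : {perm E}) : F := \prod_(i <- enum E) uvar i (s i).

Let eval_e s t : perm_eval t (e s) = (t == s)%:R.
Proof.
rewrite perm_eval_prod; under eq_bigr do rewrite perm_eval_uvar.
have [->|ts] := eqVneq t s; first by apply: big1 => i _; rewrite eqxx.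
have [i tsi] : exists i, t i != s i.
  by apply/existsP; apply: contraNT ts => /existsPn h; apply/eqP/permP => i;
     apply/eqP; have := h i; rewrite negbK.
by rewrite big_enum (bigD1 i) //= (negPf tsi) mul0r.
Qed.

Let eval_Ze c s t : perm_eval t (c%:MP * e s) = c * (t == s)%:R.
Proof. by rewrite (perm_evalM t c%:MP) (perm_evalC t c) eval_e. Qed.

Let interp f : F := \sum_(s in G) (perm_eval s f)%:MP * e s.

Let interpP f : J (f - interp f).
Proof.
move=> t tG; rewrite perm_evalB perm_eval_sum.
under eq_bigr do rewrite eval_Ze.
rewrite (bigD1 t) //= eqxx mulr1 big1 ?addr0 ?subrr //.
by move=> s /andP[_ st]; rewrite eq_sym (negPf st) mulr0.
Qed.

Let ev2h (s t : {perm E}) (x : {fmonom (E * E)%type} * {fmonom (E * E)%type}) :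
    R[i] :=
  fm_subst (fun i j => (s i == j)%:R) x.1 *
  fm_subst (fun i j => (t i == j)%:R) x.2.

Fact ev2h_morph s t : mmorphism (ev2h s t).
Proof.
rewrite /ev2h; split=> [x y|] /=; last by rewrite !mmorph1 mulr1.
by rewrite !mmorphM mulrACA.
Qed.
HB.instance Definition _ s t := isMultiplicative.Build _ _ (ev2h s t)
  (ev2h_morph s t).

Let ev2 s t (z : F2) : R[i] := mmap idfun (ev2h s t) z.

Let ev2D s t z w : ev2 s t (z + w) = ev2 s t z + ev2 s t w.
Proof. exact: mmapD. Qed.
Let ev20 s t : ev2 s t 0 = 0.
Proof. exact: mmap0. Qed.
Let ev2M s t z w : ev2 s t (z * w) = ev2 s t z * ev2 s t w.
Proof. exact: (mmap_is_multiplicative (f := idfun)).1. Qed.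
Let ev21 s t : ev2 s t 1 = 1.
Proof. exact: (mmap1 (f := idfun)). Qed.

Let ev2_tens s t f g : ev2 s t (tens f g) = perm_eval s f * perm_eval t g.
Proof.
elim/malg_ind: f => [|f f' IH IH'|c m].
- by rewrite tens0l ev20 perm_eval0 mul0r.
- by rewrite (tensDl f) (perm_evalD s f) ev2D IH IH' mulrDl.
elim/malg_ind: g => [|g g' IH IH'|d n].
- by rewrite tens0r ev20 perm_eval0 mulr0.
- by rewrite (tensDr _ g) (perm_evalD t g) ev2D IH IH' mulrDr.
by rewrite tensUU !perm_evalU /ev2 (mmapU (f := idfun)) /= mulrACA.
Qed.

Let ev2_comult s t f : ev2 s t (comult f) = perm_eval (s * t)%g f.
Proof.
elim/malg_ind: f => [|f g IHf IHg|c m].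
- by rewrite comult0 ev20 perm_eval0.
- by rewrite (comultD f) (perm_evalD _ f) ev2D IHf IHg.
rewrite perm_evalU comult.unlock mmapU ev2M; congr (_ * _).
  by rewrite /ev2 (mmapC (f := idfun)).
rewrite /fm_subst (big_morph _ (ev2M s t) (ev21 s t)); apply: eq_bigr => p _.
rewrite (big_morph _ (ev2D s t) (ev20 s t)).
under eq_bigr do rewrite ev2_tens !perm_eval_uvar.
rewrite (bigD1 (s p.1)) //= eqxx mul1r big1 ?addr0 ?permM // => k.
by rewrite eq_sym => /negPf->; rewrite mul0r.
Qed.

Let hat z : F2 :=
  \sum_(s in G) \sum_(t in G) (ev2 s t z)%:MP * tens (e s) (e t).

Let hatD z w : hat (z + w) = hat z + hat w.
Proof.
rewrite /hat -big_split; apply: eq_bigr => s _; rewrite -big_split.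
by apply: eq_bigr => t _; rewrite (ev2D s t z) rmorphD [LHS]mulrDl.
Qed.

Let hat0 z : (forall s t, s \in G -> t \in G -> ev2 s t z = 0) -> hat z = 0.
Proof.
move=> z0; apply: big1 => s sG; apply: big1 => t tG.
by rewrite z0 // malgC0E mul0r.
Qed.

Let hat_tens f g : hat (tens f g) = tens (interp f) (interp g).
Proof.
rewrite tens_suml; apply: eq_bigr => s _; rewrite tens_sumr.
by apply: eq_bigr => t _; rewrite -tensM tensUU ev2_tens.
Qed.

Let hatP z : tens_ideal J (z - hat z).
Proof.
have idK := ideal_gen_ideal (tens_rel J).
elim/malg_ind: z => [|z w IHz IHw|c [m n]].
- by rewrite hat0 ?subr0 => [|*]; [apply: (ideal0 idK)|apply: ev20].
- exact: (eq_ind_r (fun h => tens_ideal J (z + w - h))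
    (ideal_subD idK IHz IHw) (hatD z w)).
have -> : << c *g (m, n) >> = tens (<< c *g m >> : F) << n >>.
  by rewrite tensUU mulr1.
move: << c *g m >> << n >> => f g; rewrite hat_tens.
apply: (ideal_trans idK (g := tens (interp f) g)).
  by rewrite -tensBl; apply: tens_idealL; apply: interpP.
by rewrite -tensBr; apply: tens_idealR; apply: interpP.
Qed.

Fact perm_ideal_comult f : J f -> tens_ideal J (comult f).
Proof.
move=> Jf; have := hatP (comult f); rewrite hat0 ?subr0 // => s t sG tG.
by rewrite ev2_comult; apply: Jf; rewrite groupM.
Qed.

(* The algebra C(G) of functions on G. *)
Definition qperm_fun : qpermgroup :=
  QPermGroup perm_ideal_ideal perm_ideal_magic perm_ideal_star
    perm_ideal_comult.
End PermIdeal.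

End FreeAlgebra.

Record matroid (E : finType) := Matroid {
  indep : {set {set E}};
  ground_nonempty : (0 < #|E|)%N;
  indep0 : set0 \in indep;
  indepS : forall A B : {set E}, A \subset B -> B \in indep -> A \in indep;
  indep_augment : forall A B : {set E}, A \in indep -> B \in indep ->
    (#|A| < #|B|)%N -> exists2 x, x \in B :\: A & x |: A \in indep
}.

Section Matroids.
Variables (E : finType) (M : matroid E).
Implicit Types (A B F : {set E}) (x y : E) (t : seq E).

Definition rank A : nat := \max_(I in indep M | I \subset A) #|I|.
Definition matroid_rank : nat := rank setT.

Definition is_basis B : bool := maxset (mem (indep M)) B.
Definition is_circuit A : bool := minset [pred C | C \notin indep M] A.
Definition is_flat F : bool :=
  [forall (b | b \notin F), (rank F < rank (b |: F))%N].

Definition is_loop x : bool := [set x] \notin indep M.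
Definition parallel x y : bool :=
  [&& x != y, ~~ is_loop x, ~~ is_loop y & [set x; y] \notin indep M].
Definition is_simple : Prop :=
  (forall x, ~~ is_loop x) /\ (forall x y, ~~ parallel x y).

Definition is_triangle F1 F2 F3 : Prop :=
  [/\ [/\ is_flat F1, is_flat F2 & is_flat F3],
      [/\ rank F1 = 2%N, rank F2 = 2%N & rank F3 = 2%N],
      [/\ F1 :&: F2 != set0, F1 :&: F3 != set0 & F2 :&: F3 != set0] &
      F1 :&: F2 :&: F3 = set0].

Definition indep_tuple t : bool := uniq t && ([set x in t] \in indep M).
Definition basis_tuple t : bool := indep_tuple t && (size t == matroid_rank).
Definition flat_tuple t : bool := uniq t && is_flat [set x in t].
Definition circuit_tuple t : bool :=
  [exists (a | ~~ is_loop a), t == [:: a; a]] ||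
  uniq t && is_circuit [set x in t].

Definition matroid_aut : {set {perm E}} :=
  [set s : {perm E} | [forall B : {set E}, is_basis (s @: B) == is_basis B]].

Fact matroid_aut_group_set : group_set matroid_aut.
Proof.
apply/group_setP; split=> [|s t].
  rewrite inE; apply/forallP => B; apply/eqP; congr is_basis.
  by rewrite -[RHS]imset_id; apply: eq_imset => x; rewrite perm1.
rewrite !inE => /forallP hs /forallP ht; apply/forallP => B.
rewrite -(eqP (hs B)) -(eqP (ht (s @: B))); apply/eqP; congr is_basis.
by rewrite -imset_comp; apply: eq_imset => x; rewrite /= permM.
Qed.
Canonical matroid_aut_group : {group {perm E}} := Group matroid_aut_group_set.

Variable R : realType.

Definition CAut : qpermgroup R E := qperm_fun R matroid_aut_group.
Definition QAutI : qpermgroup R E := qperm_tuples R indep_tuple.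
Definition QAutB : qpermgroup R E := qperm_tuples R basis_tuple.
Definition QAutF : qpermgroup R E := qperm_tuples R flat_tuple.
Definition QAutC : qpermgroup R E := qperm_tuples R circuit_tuple.
End Matroids.

(* Main.v *)
Require Import Defs.
From mathcomp Require Import all_boot ssralg fingroup perm.
From mathcomp Require Import reals complex monalg.

(** Everything rests on padding: each row and each column of (u_ij) sums to 1,
    so u_AB is the sum of the u_(AC)(BD) over all D of the length of C, and also
    the sum over all C of the length of D. A relation imposed on long tuples
    thus passes to every short u_AB all of whose extensions are killed
    [tuple_ideal_pad].

    Flats give the classical group. The whole ground set is a flat, so an
    enumeration of E is a flat tuple while a tuple of length #|E| with a
    repetition is not. Padding [:: a; x; y] to an enumeration of E therefore
    gives u_ab u_xc u_yb = 0 for distinct a, x, y. Hence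
    u_ab u_xc = u_ab u_xc (sum_y u_yb) = u_ab u_xc u_ab; the last product is
    self-adjoint, so u_ab u_xc is too, which means that u_ab and u_xc commute
    [magic_comm]. In the commutative quotient 1 is the sum over the permutations
    s of the products e_s of the u_(i, s i), each f acts on e_s by the scalar
    perm_eval s f [eval_absorb], and e_s vanishes as soon as s moves a flat to a
    non-flat. The permutations that preserve flats are exactly the
    automorphisms, because independence can be read off from the flats
    [indep_flatP]. Hence the quotient is C(Aut M) [CAut_eq_QAutF]; the relations
    of any other Aut-invariant set of tuples hold there.

    Bases and independent sets give the same ideal because an independent tuple
    can be padded to a basis tuple and a dependent tuple cannot
    [QAutB_eq_QAutI].

    For circuits in simple rank 3, let A be a basis tuple and B a non-basis
    tuple of length 3. If B has distinct entries it is a circuit tuple and A is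
    not. If B has a repetition, the covering hypothesis gives a point outside
    the three lines spanned by pairs of entries of A
    [basis_circuit_extend]; adding it to A yields a circuit tuple of
    length 4, and no extension of B is one [QAutC_le_QAutB]. *)

Set Implicit Arguments.
Unset Strict Implicit.
Unset Printing Implicit Defensive.

(** * Matrices satisfying the magic relations modulo an ideal *)

(** The five kinds of relations of the quantum symmetric group, for a matrix
    over an arbitrary ring. Staying in an abstract ring keeps unification from
    unfolding the product of the monoid algebra. *)
Record magic_modulo (Q : nzRingType) (E : finType) (J : Q -> Prop)
    (u : E -> E -> Q) : Prop := MagicModulo {
  magic_idem : forall i j, J (u i j * u i j - u i j)%R;
  magic_row : forall i k l, k != l -> J (u i k * u i l)%R;
  magic_col : forall j k l, k != l -> J (u k j * u l j)%R;
  magic_colsum : forall j, J (\sum_k u k j - 1)%R;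
  magic_rowsum : forall i, J (\sum_k u i k - 1)%R
}.

Section MagicMatrix.
Import GRing.Theory.
Local Open Scope ring_scope.
Variables (Q : nzRingType) (E : finType) (J : Q -> Prop).
Hypothesis idJ : two_sided_ideal J.
Variable u : E -> E -> Q.
Hypothesis mag : magic_modulo J u.
Implicit Types (f g e z : Q) (a b c d i j x y : E) (A B C D : seq E).

Definition tuple_prod A B : Q := \prod_(p <- zip A B) u p.1 p.2.

Lemma tuple_prod_nil : tuple_prod [::] [::] = 1.
Proof. by rewrite /tuple_prod big_nil. Qed.

Lemma tuple_prod_cons a b A B :
  tuple_prod (a :: A) (b :: B) = u a b * tuple_prod A B.
Proof. by rewrite /tuple_prod big_cons. Qed.

Lemma tuple_prod_cat A B C D : size A = size B ->
  tuple_prod (A ++ C) (B ++ D) = tuple_prod A B * tuple_prod C D.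
Proof. by move=> sAB; rewrite /tuple_prod zip_cat // big_cat. Qed.

Lemma ideal_sub_cancel f g : J (f - g) -> J g -> J f.
Proof. by move=> fg gJ; rewrite -[f](subrK g); apply: (idealD idJ). Qed.

Lemma ideal_row_split f c : (forall d, J (f * u c d)) -> J f.
Proof.
move=> fJ; apply: (ideal_sub_cancel (g := \sum_d f * u c d)).
  rewrite -mulr_sumr -{1}[f]mulr1 -mulrBr; apply: (idealMl idJ).
  by rewrite -opprB; apply: (idealN idJ); apply: (magic_rowsum mag).
by apply: (ideal_sum idJ) => d _; apply: fJ.
Qed.

Lemma ideal_col_split f d : (forall c, J (f * u c d)) -> J f.
Proof.
move=> fJ; apply: (ideal_sub_cancel (g := \sum_c f * u c d)).
  rewrite -mulr_sumr -{1}[f]mulr1 -mulrBr; apply: (idealMl idJ).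
  by rewrite -opprB; apply: (idealN idJ); apply: (magic_colsum mag).
by apply: (ideal_sum idJ) => c _; apply: fJ.
Qed.

Lemma ideal_row_pad C f :
  (forall D, size D = size C -> J (f * tuple_prod C D)) -> J f.
Proof.
elim: C f => [|c C IH] f fJ.
  by have := fJ [::] erefl; rewrite tuple_prod_nil mulr1.
apply: (ideal_row_split (c := c)) => d; apply: IH => D sD.
by rewrite -mulrA -tuple_prod_cons; apply: fJ; rewrite /= sD.
Qed.

Lemma ideal_col_pad D f :
  (forall C, size C = size D -> J (f * tuple_prod C D)) -> J f.
Proof.
elim: D f => [|d D IH] f fJ.
  by have := fJ [::] erefl; rewrite tuple_prod_nil mulr1.
apply: (ideal_col_split (d := d)) => c; apply: IH => C sC.
by rewrite -mulrA -tuple_prod_cons; apply: fJ; rewrite /= sC.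
Qed.

Lemma tuple_prod_row_pad C A B : size A = size B ->
  (forall D, size D = size C -> J (tuple_prod (A ++ C) (B ++ D))) ->
  J (tuple_prod A B).
Proof.
move=> sAB h; apply: (ideal_row_pad (C := C)) => D sD.
by rewrite -tuple_prod_cat //; apply: h.
Qed.

Lemma tuple_prod_col_pad D A B : size A = size B ->
  (forall C, size C = size D -> J (tuple_prod (A ++ C) (B ++ D))) ->
  J (tuple_prod A B).
Proof.
move=> sAB h; apply: (ideal_col_pad (D := D)) => C sC.
by rewrite -tuple_prod_cat //; apply: h.
Qed.

(** If f and g act on e by p and q, then f g acts by q p: the factor q has to
    be moved across f. *)
Lemma absorbM e f g p q : GRing.comm f q ->
  J (f * e - p * e) -> J (g * e - q * e) -> J (f * g * e - q * p * e).
Proof.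
move=> fq fe ge; apply: (ideal_trans idJ (g := f * (q * e))).
  by rewrite -mulrA -mulrBr; apply: (idealMl idJ).
by rewrite mulrA fq -!mulrA -mulrBr; apply: (idealMl idJ).
Qed.

Section Commutation.
Variable star : Q -> Q.
Hypothesis starB : forall f g, star (f - g) = star f - star g.
Hypothesis starM : forall f g, star (f * g) = star g * star f.
Hypothesis star_u : forall i j, star (u i j) = u i j.
Hypothesis starJ : forall f, J f -> J (star f).
Hypothesis no_return : forall a x y b c,
  uniq [:: a; x; y] -> J (tuple_prod [:: a; x; y] [:: b; c; b]).

(** Expanding 1 as the sum of column b on the right of u_ab u_xc leaves only
    the term u_ab u_xc u_ab, which the involution fixes. *)
Lemma magic_comm a b x c : J (u a b * u x c - u x c * u a b).
Proof.
have sandwich : J (u a b * u x c - u a b * u x c * u a b).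
  apply: (ideal_col_split (d := b)) => y; rewrite mulrBl.
  have [->|ya] := eqVneq y a.
    rewrite -[X in _ - X]mulrA -mulrBr; apply: (idealMl idJ).
    by rewrite -opprB; apply: (idealN idJ); apply: (magic_idem mag).
  apply: (idealB idJ); last first.
    rewrite -(mulrA (u a b * u x c)); apply: (idealMl idJ).
    by apply: (magic_col mag); rewrite eq_sym.
  have [xa|xa] := eqVneq x a.
    have [->|bc] := eqVneq c b; last first.

      apply: (idealMr idJ); rewrite xa.
      by apply: (magic_row mag); rewrite eq_sym.
    rewrite -mulrA; apply: (idealMl idJ).
    by apply: (magic_col mag); rewrite xa eq_sym.
  have [yx|yx] := eqVneq y x.
    have [->|cb] := eqVneq c b; last first.
      rewrite -mulrA; apply: (idealMl idJ); rewrite yx.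
      exact: (magic_row mag).
    by apply: (idealMr idJ); apply: (magic_col mag); rewrite eq_sym.
  have := @no_return a x y b c; rewrite !tuple_prod_cons tuple_prod_nil mulr1.
  rewrite mulrA; apply.
  by rewrite /= !inE negb_or ![a == _]eq_sym [x == y]eq_sym xa ya yx.
apply: (ideal_trans idJ sandwich).
have := starJ sandwich; rewrite starB !starM !star_u mulrA => h.
by rewrite -opprB; apply: (idealN idJ).
Qed.

(** Once the entries commute, u_ij can be moved next to the factor of row i,
    which it fixes or kills. *)
Lemma magic_absorb (s : {perm E}) A i j : i \in A ->
  J (u i j * tuple_prod A (map s A) -
     (s i == j)%:R * tuple_prod A (map s A)).
Proof.
elim: A => //= a A IH; rewrite inE tuple_prod_cons.
have [-> _|ia /= iA] := eqVneq i a.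
  rewrite [in X in X - _]mulrA [in X in _ - X]mulrA -mulrBl.
  apply: (idealMr idJ); have [<-|sj] := eqVneq (s a) j.
    by rewrite mul1r; apply: (magic_idem mag).
  by rewrite mul0r subr0; apply: (magic_row mag); rewrite eq_sym.
apply: (ideal_trans idJ
  (g := u a (s a) * (u i j * tuple_prod A (map s A)))).
  by rewrite !mulrA -mulrBl; apply: (idealMr idJ); apply: magic_comm.
rewrite [in X in _ - X]mulrA -(commr_nat (u a (s a))) -[in X in _ - X]mulrA.
by rewrite -mulrBr; apply: (idealMl idJ); apply: IH.
Qed.
End Commutation.
End MagicMatrix.

(** * The ideals of sets of tuples *)

Section TupleIdeals.
Import GRing.Theory.
Local Open Scope ring_scope.
Variables (R : realType) (E : finType).
Local Notation F := (ncpoly R E).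
Implicit Types (f : F) (A B C D : seq E) (T : pred (seq E)).

Lemma tuple_ideal_magic_modulo T :
  magic_modulo (tuple_ideal T) (@uvar R E).
Proof.
split=> *; apply: ideal_gen_in; apply: TupleMagic.
- exact: MagicIdem.
- exact: MagicRow.
- exact: MagicCol.
- exact: MagicColSum.
- exact: MagicRowSum.
Qed.

Lemma uprodE A B : uprod R A B = tuple_prod (@uvar R E) A B.
Proof. by []. Qed.

(** Padding: u_AB is the sum of the generators u_(AC)(BD) over D by the row
    sums, and u_BA the sum of the generators u_(BD)(AC) by the column sums. *)
Lemma tuple_ideal_pad T A B C : size A = size B -> in_Tup (A ++ C) ->
  T (A ++ C) -> (forall D, size D = size C -> ~~ T (B ++ D)) ->
  tuple_ideal T (uprod R A B) /\ tuple_ideal T (uprod R B A).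
Proof.
move=> sAB tAC TAC nT.
have sep D : size D = size C ->
    [/\ in_Tup (B ++ D), size (A ++ C) = size (B ++ D) & ~~ T (B ++ D)].
  by move=> sD; rewrite nT // /in_Tup !size_cat -sAB sD -size_cat.
split; rewrite uprodE.
  apply: (tuple_prod_row_pad (tuple_ideal_ideal R T)
    (tuple_ideal_magic_modulo T) sAB (C := C)) => D /sep[tBD sBD nTBD].
  by apply: ideal_gen_in; apply: TupleSep; rewrite ?TAC.
apply: (tuple_prod_col_pad (tuple_ideal_ideal R T)
  (tuple_ideal_magic_modulo T) (esym sAB) (D := C)) => D /sep[tBD sBD nTBD].
by apply: ideal_gen_in; apply: TupleSep; rewrite ?TAC ?(negPf nTBD).
Qed.

Lemma tuple_ideal_sub T T' f :
  (forall A B, in_Tup A -> in_Tup B -> size A = size B -> T A -> ~~ T B ->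
     tuple_ideal T' (uprod R A B) /\ tuple_ideal T' (uprod R B A)) ->
  tuple_ideal T f -> tuple_ideal T' f.
Proof.
move=> TT'; apply; first exact: tuple_ideal_ideal.
move=> _ [g mg|A B tA tB sAB]; first by apply: ideal_gen_in; apply: TupleMagic.
have [TA|TA] := boolP (T A); have [TB|TB] := boolP (T B) => // _.
  exact: (TT' A B tA tB sAB TA TB).1.
exact: (TT' B A tB tA (esym sAB) TB TA).2.
Qed.

Lemma perm_eval_uprod (s : {perm E}) A B : size A = size B ->
  perm_eval s (uprod R A B) = (map s A == B)%:R.
Proof.
elim: A B => [|a A IH] [|b B] //=; first by rewrite uprod_nil perm_eval1.
move=> [sAB]; rewrite uprod_cons (perm_evalM s) perm_eval_uvar (IH _ sAB).
by rewrite -natrM mulnb eqseq_cons.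
Qed.

Lemma perm_ideal_of_tuple_ideal T (G : {group {perm E}}) f :
  (forall s, s \in G -> forall A, in_Tup A -> T (map s A) = T A) ->
  tuple_ideal T f -> perm_ideal G f.
Proof.
move=> GT; apply; first exact: perm_ideal_ideal.
move=> _ [g mg|A B tA tB sAB TAB].
  by apply: perm_ideal_magic; apply: ideal_gen_in.
move=> s sG; rewrite perm_eval_uprod //.
by case: eqP => // sA; rewrite -sA GT ?eqxx in TAB.
Qed.

Lemma uniq_full_perm B : uniq B -> size B = #|E| ->
  exists s : {perm E}, B = map s (enum E).
Proof.
move=> uB sB; have sBE : size B = size (enum E) by rewrite sB cardE.
case E0: (enum E) => [|x0 r].
  by exists 1%g; apply/size0nil; rewrite sBE E0.
pose g x := nth x0 B (index x (enum E)).
have lt_ind x : (index x (enum E) < size B)%N.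
  by rewrite sBE index_mem mem_enum.
have g_inj : injective g.
  move=> x y /eqP; rewrite nth_uniq // => /eqP /(congr1 (nth x0 (enum E))).
  by rewrite !nth_index ?mem_enum.
exists (perm g_inj); rewrite -E0.
apply: (@eq_from_nth _ x0) => [|i ltiB]; first by rewrite size_map.
have ltiE : (i < size (enum E))%N by rewrite -sBE.
by rewrite (nth_map x0) // permE /g index_uniq ?enum_uniq.
Qed.

(** A set of tuples whose members of length #|E| are the repetition-free ones
    defines a commutative quotient, hence the functions on a classical
    group. *)
Section Separating.
Variables (T : pred (seq E)) (G : {group {perm E}}).
Hypothesis T_full : forall A, size A = #|E| -> T A = uniq A.
Local Notation J := (tuple_ideal T).
Let idJ : two_sided_ideal J := tuple_ideal_ideal R T.
Let mag : magic_modulo J (@uvar R E) := tuple_ideal_magic_modulo T.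

(** Padding a, x, y to an enumeration of E: no word of full length that
    starts with b, c, b is repetition-free. *)
Lemma no_return_of_full a x y b c : uniq [:: a; x; y] ->
  J (uprod R [:: a; x; y] [:: b; c; b]).
Proof.
move=> axy; pose C := filter [predC [:: a; x; y]] (enum E).
have CE : perm_eq ([:: a; x; y] ++ C) (enum E).
  apply: uniq_perm; last 2 [by rewrite enum_uniq].
  - rewrite cat_uniq axy filter_uniq ?enum_uniq // andbT.
    by apply/hasPn => z; rewrite mem_filter => /andP[].
  - move=> z; rewrite mem_cat mem_filter mem_enum andbT.
    exact: orbN.
have sC : size ([:: a; x; y] ++ C) = #|E| by rewrite (perm_size CE) cardE.
apply: (tuple_ideal_pad (C := C) _ _ _ _).1 => // [||D sD].
- by rewrite /in_Tup sC.
- by rewrite T_full // (perm_uniq CE) enum_uniq.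
- by rewrite T_full -?sC ?size_cat ?sD //= !inE eqxx orbT.
Qed.

Lemma uvar_absorb (s : {perm E}) A i j : i \in A ->
  J (uvar i j * uprod R A (map s A) - (s i == j)%:R * uprod R A (map s A)).
Proof.
apply: (magic_absorb idJ mag (star := nc_star)).
- exact: nc_starB.
- exact: nc_starM.
- exact: nc_star_uvar.
- exact: tuple_ideal_star.
- exact: no_return_of_full.
Qed.

(** The product of the u_(i, s i) over all i plays the part of the indicator
    function of s: it absorbs each generator, hence each f, up to the value of
    f at s. *)
Lemma eval_absorb (s : {perm E}) f :
  J (f * uprod R (enum E) (map s (enum E)) -
     (perm_eval s f)%:MP * uprod R (enum E) (map s (enum E))).
Proof.
set e := uprod R _ _.
(* The f that act on e by perm_eval s f are closed under products. *)
have absM g h : J (g * e - (perm_eval s g)%:MP * e) ->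
    J (h * e - (perm_eval s h)%:MP * e) ->
    J (g * h * e - (perm_eval s (g * h))%:MP * e).
  move=> hg hh; rewrite perm_evalM (mulrC (perm_eval s g)) rmorphM.
  exact: (absorbM idJ (commr_sym (malgC_comm _ _)) hg hh).
elim/malg_ind: f => [|f g IHf IHg|c m].
- by rewrite perm_eval0 malgC0E !mul0r subrr; apply: (ideal0 idJ).
- rewrite (perm_evalD s f) rmorphD (mulrDl f) [X in _ - X]mulrDl.
  exact: (ideal_subD idJ IHf IHg).
have -> : << c *g m >> = c%:MP * << m >> :> F.
  by rewrite malgMUU mulr1 mul1m.
apply: (absM); first by rewrite perm_evalC subrr; apply: (ideal0 idJ).
case: m => l; elim: l => [|[i j] l IH].
  have -> : << FMonom [::] >> = 1 :> F by rewrite -fmoneE.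
  by rewrite perm_eval1 rmorph1 subrr; apply: (ideal0 idJ).
have -> : << FMonom ((i, j) :: l) >> = uvar i j * << FMonom l >> :> F.
  by rewrite uvarE malgMUU mulr1; congr << _ *g _ >>; rewrite [RHS]fmmulE.
apply: (absM _ _ _ IH); rewrite perm_eval_uvar rmorph_nat.
by apply: uvar_absorb; rewrite mem_enum.
Qed.

(** Padding f with an enumeration of E writes f as a sum of f times
    u_(enum E, B). Words B with a repetition are killed by the full-length
    relations, permutations in G by the vanishing of f on G, and a permutation s
    outside G by a tuple A that it does not respect: u_(A, sA) lies in the ideal
    and acts as 1 on the factor of s. *)
Lemma tuple_ideal_of_perm_ideal f :
  (forall s, s \notin G -> exists2 A, in_Tup A & T (map s A) != T A) ->
  perm_ideal G f -> J f.
Proof.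
move=> GT Gf.
apply: (ideal_row_pad idJ mag (C := enum E)) => B sB.
rewrite -uprodE.
have sE : size (enum E) = #|E| by rewrite cardE.
rewrite sE in sB; have [uB|nuB] := boolP (uniq B); last first.
  apply: (idealMl idJ); apply: ideal_gen_in.
  apply: TupleSep; rewrite /in_Tup ?sB ?sE //.
  by rewrite !T_full ?sB // enum_uniq (negPf nuB).
have [s ->] := uniq_full_perm uB sB.
have absorb := eval_absorb s; set e := uprod R _ _ in absorb *.
have [sG|/GT[A tA TsA]] := boolP (s \in G).
  by have := absorb f; rewrite (Gf s sG) malgC0E mul0r subr0.
apply: (idealMl idJ).
have := absorb (uprod R A (map s A)).
rewrite perm_eval_uprod ?size_map // eqxx rmorph1 mul1r => h.
have {h} := idealN idJ h; rewrite opprB => /(ideal_sub_cancel idJ); apply.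
apply: (idealMr idJ); apply: ideal_gen_in.
apply: TupleSep; rewrite ?size_map //.
  by rewrite /in_Tup size_map.
by rewrite eq_sym.
Qed.
End Separating.
End TupleIdeals.

(** * Matroids: flats, automorphisms and bases *)

Section MatroidTheory.
Variables (E : finType) (M : matroid E).
Implicit Types (A B C F I J K : {set E}) (x y b : E) (t : seq E) (s : {perm E}).

Lemma rank_ge A I : I \in indep M -> I \subset A -> (#|I| <= rank M A)%N.
Proof.
move=> iI sIA; rewrite /rank.
by apply: (leq_bigmax_cond I); rewrite iI.
Qed.

Lemma rank_le A n :
  (forall I, I \in indep M -> I \subset A -> (#|I| <= n)%N) ->
  (rank M A <= n)%N.
Proof. by move=> h; apply/bigmax_leqP => I /andP[]; apply: h. Qed.

Lemma rank_witness A :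
  exists2 I, I \in indep M & (I \subset A) && (#|I| == rank M A).
Proof.
have [|I /andP[iI sIA] e] := @eq_bigmax_cond _
  [pred I : {set E} | (I \in indep M) && (I \subset A)]
  (fun J : {set E} => #|J|).
  by apply/card_gt0P; exists set0; rewrite inE /= indep0 sub0set.
by exists I => //; rewrite sIA /rank e eqxx.
Qed.

Lemma indep_extend A B : A \in indep M -> B \in indep M ->
  exists2 I, I \in indep M &
    [&& A \subset I, I \subset A :|: B & (#|B| <= #|I|)%N].
Proof.
have [n] := ubnP (#|B| - #|A|); elim: n A => // n IH A lt iA iB.
have [leBA|ltAB] := leqP #|B| #|A|.
  by exists A; rewrite ?subxx ?subsetUl.
have [x /setDP[xB xA] ixA] := indep_augment iA iB ltAB.
have cxA : #|x |: A| = #|A|.+1 by rewrite cardsU1 xA.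
have [|I iI /and3P[sAI sIB leI]] := IH _ _ ixA iB.
  by rewrite cxA; move: lt; rewrite -(subnSK ltAB) ltnS.
exists I => //; rewrite leI (subset_trans (subsetUr _ _) sAI) /= andbT.
apply: subset_trans sIB _; rewrite -setUA subUset subxx andbT sub1set.
by rewrite inE xB orbT.
Qed.

(** The closure of I in the usual sense only for independent I, the sole case
    below. *)
Definition span I := [set y | (y \in I) || (y |: I \notin indep M)].

Lemma sub_span I : I \subset span I.
Proof. by apply/subsetP => x xI; rewrite inE xI. Qed.

Lemma rank_span I : I \in indep M -> rank M (span I) = #|I|.
Proof.
move=> iI; apply/eqP; rewrite eqn_leq rank_ge ?sub_span // andbT.
apply: rank_le => J iJ sJ; rewrite leqNgt; apply/negP => ltIJ.
have [x /setDP[xJ xI] ixI] := indep_augment iI iJ ltIJ.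
by have := subsetP sJ x xJ; rewrite inE (negPf xI) ixI.
Qed.

Lemma span_flat I : I \in indep M -> is_flat M (span I).
Proof.
move=> iI; apply/forall_inP => b; rewrite inE negb_or negbK => /andP[bI ibI].
rewrite rank_span // -[#|I|.+1]/(1 + #|I|)%N.
have <- : #|b |: I| = (1 + #|I|)%N by rewrite cardsU1 bI.
by apply: rank_ge => //; apply: setUS; apply: sub_span.
Qed.

Lemma flat_extend F J b : is_flat M F -> J \in indep M -> J \subset F ->
  b \notin F -> b |: J \in indep M.
Proof.
move=> /forall_inP flF iJ sJF bF.
have [K iK /andP[sK /eqP cK]] := rank_witness (b |: F).
have [I iI /and3P[sJI sIJK leKI]] := indep_extend iJ iK.
have sIbF : I \subset b |: F.
  apply: subset_trans sIJK _.
  by rewrite subUset sK (subset_trans sJF) ?subsetUr.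
have bI : b \in I.
  apply: contraTT (flF b bF) => bI; rewrite -leqNgt -cK.
  apply: leq_trans leKI _; apply: rank_ge => //.
  apply/subsetP => x xI; have := subsetP sIbF x xI.
  rewrite !inE => /predU1P[xb|//].
  by rewrite -xb xI in bI.
by apply: indepS iI; rewrite subUset sub1set bI.
Qed.

(** For independent I the span of I minus x is a flat that avoids x.
    Conversely, if J is a maximal independent subset of I and misses x, a flat
    that contains I minus x but not x would allow adding x to J. *)
Lemma indep_flatP I : reflect
  (forall x, x \in I ->
     exists2 F, is_flat M F & (I :\ x \subset F) && (x \notin F))
  (I \in indep M).
Proof.
apply: (iffP idP) => [iI x xI|h].
  have iIx : I :\ x \in indep M by apply: indepS iI; apply: subsetDl.
  exists (span (I :\ x)); first exact: span_flat.
  by rewrite sub_span !inE eqxx /= setD1K // negbK.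
have [J /maxsetP[/andP[iJ sJI] maxJ] _] : {J | maxset
    [pred J : {set E} | (J \in indep M) && (J \subset I)] J & set0 \subset J}.
  by apply: maxset_exists; rewrite /= indep0 sub0set.
have [<-//|neqJI] := eqVneq J I.
have /properP[_ [x xI xJ]] : J \proper I by rewrite properEneq neqJI.
have [F flF /andP[sIF xF]] := h x xI.
have sJF : J \subset F.
  by apply: subset_trans sIF; rewrite subsetD1 sJI.
have ixJ := flat_extend flF iJ sJF xF.
have xJE : x |: J = J.
  by apply: maxJ; rewrite ?subsetUr //= ixJ subUset sub1set xI.
by rewrite -xJE setU11 in xJ.
Qed.

Lemma indep_basis I : I \in indep M -> exists2 B, is_basis M B & I \subset B.
Proof.
by move=> iI; have [B] := maxset_exists (P := mem (indep M)) iI; exists B.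
Qed.

Section Symmetry.
Variable s : {perm E}.

Lemma sub_imset_perm A B : (s @: A \subset s @: B) = (A \subset B).
Proof.
apply/idP/idP => [/subsetP sAB|]; last exact: imsetS.
apply/subsetP => x xA; have := sAB (s x); rewrite !(mem_imset _ _ perm_inj).
exact.
Qed.

Lemma imset_permD1 A x : s @: (A :\ x) = s @: A :\ s x.
Proof.
apply/setP => y; rewrite -[y](permKV s) !inE !(mem_imset _ _ perm_inj) !inE.
by rewrite (inj_eq perm_inj).
Qed.

Lemma perm_preimset A : exists B, A = s @: B.
Proof.
exists (s^-1%g @: A); rewrite -imset_comp -[LHS]imset_id.
by apply: eq_imset => x /=; rewrite permKV.
Qed.

Lemma minset_perm (P Q : pred {set E}) A :
  (forall B, P (s @: B) = Q B) -> minset P (s @: A) = minset Q A.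
Proof.
move=> PQ; apply/minsetP/minsetP => -[PA minA]; split=> [|B].
- by rewrite -PQ.
- move=> QB sBA; apply: (imset_inj (@perm_inj _ s)).
  by apply: minA; rewrite ?PQ ?sub_imset_perm.
- by rewrite PQ.
- have [C ->] := perm_preimset B; rewrite PQ sub_imset_perm => QC sCA.
  by rewrite (minA C).
Qed.

Lemma maxset_perm (P Q : pred {set E}) A :
  (forall B, P (s @: B) = Q B) -> maxset P (s @: A) = maxset Q A.
Proof.
move=> PQ; apply/maxsetP/maxsetP => -[PA maxA]; split=> [|B].
- by rewrite -PQ.
- move=> QB sBA; apply: (imset_inj (@perm_inj _ s)).
  by apply: maxA; rewrite ?PQ ?sub_imset_perm.
- by rewrite PQ.
- have [C ->] := perm_preimset B; rewrite PQ sub_imset_perm => QC sCA.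
  by rewrite (maxA C).
Qed.
End Symmetry.

Lemma matroid_autP s : reflect
  (forall I, (s @: I \in indep M) = (I \in indep M)) (s \in matroid_aut M).
Proof.
rewrite inE; apply: (iffP forallP) => [basis_s I|indep_s B]; last first.
  by apply/eqP/maxset_perm.
apply/idP/idP => /indep_basis[B bB sIB].
  have [C BC] := perm_preimset s B.
  rewrite BC sub_imset_perm in sIB; apply: (indepS sIB).
  by rewrite BC (eqP (basis_s C)) in bB; case/maxsetP: bB.
have : is_basis M (s @: B) by rewrite (eqP (basis_s B)).
by case/maxsetP=> isB _; apply: indepS isB; apply: imsetS.
Qed.

Section Automorphism.
Variable s : {perm E}.
Hypothesis s_aut : s \in matroid_aut M.
Let s_indep I : (s @: I \in indep M) = (I \in indep M) :=
  matroid_autP s s_aut I.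

Lemma rank_perm A : rank M (s @: A) = rank M A.
Proof.
rewrite /rank (reindex_inj (imset_inj (@perm_inj _ s))) /=.
apply: eq_big => [I|I _]; first by rewrite s_indep sub_imset_perm.
by rewrite card_imset //; apply: perm_inj.
Qed.

Lemma flat_perm F : is_flat M (s @: F) = is_flat M F.
Proof.
apply/forall_inP/forall_inP => flF b.
  move=> bF; have := flF (s b); rewrite (mem_imset _ _ perm_inj) -imsetU1.
  by rewrite !rank_perm; apply.
rewrite -[b](permKV s) (mem_imset _ _ perm_inj) => /flF.
by rewrite -imsetU1 !rank_perm.
Qed.

Lemma circuit_perm A : is_circuit M (s @: A) = is_circuit M A.
Proof. by apply: minset_perm => B; rewrite /= s_indep. Qed.

Lemma set_map_perm t : [set x in map s t] = s @: [set x in t].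
Proof.
apply/setP => x; rewrite inE; apply/mapP/imsetP => -[y yt ->]; exists y => //.
  by rewrite inE.
by rewrite inE in yt.
Qed.

Lemma indep_tuple_perm t : indep_tuple M (map s t) = indep_tuple M t.
Proof.
by rewrite /indep_tuple (map_inj_uniq perm_inj) set_map_perm s_indep.
Qed.

Lemma basis_tuple_perm t : basis_tuple M (map s t) = basis_tuple M t.
Proof. by rewrite /basis_tuple indep_tuple_perm size_map. Qed.

Lemma flat_tuple_perm t : flat_tuple M (map s t) = flat_tuple M t.
Proof.
by rewrite /flat_tuple (map_inj_uniq perm_inj) set_map_perm flat_perm.
Qed.

Lemma circuit_tuple_perm t : circuit_tuple M (map s t) = circuit_tuple M t.
Proof.
rewrite /circuit_tuple (map_inj_uniq perm_inj) set_map_perm circuit_perm.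
congr (_ || _); apply/exists_inP/exists_inP => -[a la /eqP ta].
  exists (s^-1%g a).
    by rewrite /is_loop -s_indep imset_set1 permKV.
  by rewrite -(inj_eq (inj_map (@perm_inj _ s))) ta /= permKV.
exists (s a); last by rewrite ta.
by rewrite /is_loop -imset_set1 s_indep.
Qed.
End Automorphism.

(** The criterion [indep_flatP] mentions only flats, so it is transported by
    a permutation of E that preserves them. *)
Lemma flats_aut s : (forall F, is_flat M (s @: F) = is_flat M F) ->
  s \in matroid_aut M.
Proof.
move=> flat_s; apply/matroid_autP => I.
apply/indep_flatP/indep_flatP => h x.
  move=> xI; have [|F] := h (s x); first by rewrite (mem_imset _ _ perm_inj).
  have [G ->] := perm_preimset s F; rewrite flat_s (mem_imset _ _ perm_inj).
  by rewrite -imset_permD1 sub_imset_perm; exists G.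
move=> /imsetP[y yI ->]; have [F flF /andP[sIF yF]] := h y yI.
exists (s @: F); first by rewrite flat_s.
rewrite (mem_imset _ _ perm_inj) yF andbT.
by rewrite -imset_permD1 sub_imset_perm.
Qed.

Lemma flat_separates s : s \notin matroid_aut M ->
  exists2 t, in_Tup t & flat_tuple M (map s t) != flat_tuple M t.
Proof.
move=> snA; have [F flF] : exists F, is_flat M (s @: F) != is_flat M F.
  apply/existsP; apply: contraNT snA => /existsPn h.
  by apply: flats_aut => F; have := h F; rewrite negbK => /eqP.
exists (enum F); first by rewrite /in_Tup -cardE max_card.
rewrite /flat_tuple (map_inj_uniq perm_inj) set_map_perm enum_uniq /=.
by rewrite set_enum.
Qed.

Lemma flat_tuple_full t : size t = #|E| -> flat_tuple M t = uniq t.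
Proof.
move=> st; rewrite /flat_tuple andb_idr // => ut.
have -> : [set x in t] = setT.
  by apply/eqP; rewrite eqEcard subsetT cardsT cardsE (card_uniqP ut) st leqnn.
by apply/forall_inP => b; rewrite inE.
Qed.
Lemma uniq_in_Tup t : uniq t -> in_Tup t.
Proof. by move=> /card_uniqP; rewrite /in_Tup => <-; apply: max_card. Qed.

Lemma indep_tuple_catl t1 t2 : indep_tuple M (t1 ++ t2) -> indep_tuple M t1.
Proof.
rewrite /indep_tuple cat_uniq => /andP[/and3P[-> _ _]]; apply: indepS.
by apply/subsetP => x; rewrite !inE mem_cat => ->.
Qed.

Lemma indep_tuple_extend t1 :
  indep_tuple M t1 -> exists t2, basis_tuple M (t1 ++ t2).
Proof.
move=> /andP[u1 i1]; have [K iK /andP[_ /eqP cK]] := rank_witness setT.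
have [I iI /and3P[s1I _ leKI]] := indep_extend i1 iK.
have cI : #|I| = matroid_rank M.
  by apply/eqP; rewrite eqn_leq rank_ge ?subsetT //= /matroid_rank -cK.
exists (enum (I :\: [set x in t1])).
have mem_t : t1 ++ enum (I :\: [set x in t1]) =i I.
  move=> x; rewrite mem_cat mem_enum !inE; have [xt|//] := boolP (x \in t1).
  by rewrite (subsetP s1I) // inE.
have u : uniq (t1 ++ enum (I :\: [set x in t1])).
  rewrite cat_uniq u1 enum_uniq andbT; apply/hasPn => x.
  by rewrite mem_enum !inE => /andP[].
rewrite /basis_tuple /indep_tuple u -(card_uniqP u) (eq_card mem_t) cI eqxx.
rewrite andbT.
by rewrite (_ : [set x in _] = I) //; apply/setP => x; rewrite inE mem_t.
Qed.

Lemma circuit_of_indepD1 A : A \notin indep M ->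
  (forall x, x \in A -> A :\ x \in indep M) -> is_circuit M A.
Proof.
move=> dA h; apply/minsetP; split=> // C /= dC sCA; apply/eqP.
rewrite eqEproper sCA; apply: contra dC => /properP[_ [x xA xC]].
by apply: (indepS _ (h x xA)); rewrite subsetD1 sCA.
Qed.

Lemma basis_tuple_not_circuit t :
  basis_tuple M t -> 2 < matroid_rank M -> circuit_tuple M t = false.
Proof.
move=> /andP[/andP[u i] /eqP st] r3; apply/negbTE/norP; split.
  by apply/exists_inP => -[a _ /eqP ta]; rewrite -st ta in r3.
by apply/andP => -[_ /minsetP[/negP]].
Qed.

Lemma circuit_tuple_uniq t : circuit_tuple M t -> 2 < size t -> uniq t.
Proof. by case/orP=> [/exists_inP[a _ /eqP->]|/andP[]]. Qed.

(** * Circuits of simple matroids of rank 3 *)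

Section SimpleRank3.
Hypothesis M_simple : is_simple M.
Hypothesis rank3 : matroid_rank M = 3.

Lemma simple_indep2 A : #|A| <= 2 -> A \in indep M.
Proof.
have [noloop nopar] := M_simple.
rewrite leq_eqVlt => /orP[/cards2P[x [y [xy ->]]]|].
  by have := nopar x y; rewrite /parallel xy !noloop negbK.
rewrite ltnS leq_eqVlt => /orP[/cards1P[x ->]|].
  by have := noloop x; rewrite negbK.
by rewrite ltnS leqn0 cards_eq0 => /eqP->; apply: indep0.
Qed.

Lemma simple_indepU2 x y : [set x; y] \in indep M.
Proof. by apply: simple_indep2; rewrite cards2; case: (_ == _). Qed.

Lemma dependent_triple_circuit t :
  size t = 3 -> uniq t -> ~~ basis_tuple M t -> circuit_tuple M t.
Proof.
move=> st ut; rewrite /basis_tuple st rank3 andbT /indep_tuple ut => dt.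
rewrite /circuit_tuple ut circuit_of_indepD1 ?orbT // => x xt.
apply: simple_indep2; rewrite -ltnS.
have -> : 3 = #|[set x in t]| by rewrite cardsE (card_uniqP ut).
by rewrite [X in _ < X](cardsD1 x) xt.
Qed.

(** Otherwise the independent pair y, a could be enlarged by one of b, c, while
    y lies on both lines. *)
Lemma spans_meet a b c y : indep_tuple M [:: a; b; c] ->
  y \in span [set a; b] -> y \in span [set a; c] -> y = a.
Proof.
move=> /andP[u i] yab yac; apply/eqP; apply/negPn/negP => ya.
have lt : #|[set y; a]| < #|[set x in [:: a; b; c]]|.
  by rewrite cards2 ya cardsE (card_uniqP u).
have [x /setDP[]] := indep_augment (simple_indepU2 y a) i lt.
rewrite !inE !negb_or => /or3P[]/eqP-> /andP[xy]; rewrite ?eqxx // => _ ix.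
  move: yab; rewrite !inE (negPf ya) eq_sym (negPf xy) /=.
  by rewrite setUA setUC ix.
move: yac; rewrite !inE (negPf ya) eq_sym (negPf xy) /=.
by rewrite setUA setUC ix.
Qed.

Hypothesis no_cover : forall F1 F2 F3 : {set E},
  is_triangle M F1 F2 F3 -> [set: E] <> F1 :|: F2 :|: F3.

(** The lines through two of three non-collinear points form a triangle; a
    point outside their union is in general position with the three points. *)
Lemma basis_circuit_extend t :
  basis_tuple M t -> exists a, circuit_tuple M (t ++ [:: a]).
Proof.
case/andP=> + /eqP; rewrite rank3; case: t => [|a [|b [|c []]]] // iabc _.
have /andP[u i] := iabc.
have [ab ac bc] : [/\ a != b, a != c & b != c].
  by move: u; rewrite /= !inE negb_or andbT => /andP[/andP[]].
have ibac : indep_tuple M [:: b; a; c].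
  apply/andP; split; first by rewrite /= !inE negb_or eq_sym ab ac bc.
  rewrite (_ : finset _ = [set x in [:: a; b; c]]) //.
  by apply/setP => y; rewrite !inE orbCA.
have fl x y : is_flat M (span [set x; y]) by apply/span_flat/simple_indepU2.
have rk x y : x != y -> rank M (span [set x; y]) = 2.
  by move=> xy; rewrite rank_span ?simple_indepU2 // cards2 xy.
have tri : is_triangle M (span [set a; b]) (span [set a; c]) (span [set b; c]).
  split; [by split|by split; apply: rk| |].
    by split; apply/set0Pn; [exists a|exists b|exists c];
      rewrite !inE eqxx ?orbT.
  apply/setP => y; rewrite in_set0; apply/negbTE.
  rewrite !in_setI -andbA; apply/and3P => -[yab yac ybc].
  have ya := spans_meet iabc yab yac.
  rewrite setUC in yab; have yb := spans_meet ibac yab ybc.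
  by rewrite -ya yb eqxx in ab.
have [d] : exists d,
    d \notin span [set a; b] :|: span [set a; c] :|: span [set b; c].
  apply/existsP; apply: contra_notT (no_cover tri) => /existsPn h.
  apply/esym/setP => y; rewrite [RHS]inE -[LHS]negbK.
  by apply/negP; apply/negP: (h y).
rewrite !inE !negb_or !negbK -!andbA.
move=> /and3P[da db /and5P[iab _ dc iac /and3P[_ _ ibc]]].
have ud : uniq [:: a; b; c; d].
  by rewrite /= !inE !negb_or ab ac bc ![_ == d]eq_sym da db dc.
exists d; rewrite /circuit_tuple [uniq _]ud circuit_of_indepD1 ?orbT //.
  apply/negP => iA; have := rank_ge iA (subsetT _).
  by rewrite cardsE (card_uniqP ud) -/(matroid_rank M) rank3.
move=> x; rewrite !inE => /or4P[]/eqP->.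
- by apply: indepS ibc; apply/subsetP => y; rewrite !inE; do 4![case: (_ == _)].
- by apply: indepS iac; apply/subsetP => y; rewrite !inE; do 4![case: (_ == _)].
- by apply: indepS iab; apply/subsetP => y; rewrite !inE; do 4![case: (_ == _)].
- by apply: indepS i; apply/subsetP => y; rewrite !inE; do 4![case: (_ == _)].
Qed.
End SimpleRank3.
End MatroidTheory.

(** * The quantum automorphism groups *)

Section MatroidQuantumGroups.
Variables (R : realType) (E : finType) (M : matroid E).
Implicit Types (A B : seq E).

Lemma CAut_eq_QAutF : qperm_eq (CAut M R) (QAutF M R).
Proof.
move=> f; split.
  apply: tuple_ideal_of_perm_ideal; first exact: flat_tuple_full.
  exact: flat_separates.
apply: perm_ideal_of_tuple_ideal => s s_aut A _.
exact: flat_tuple_perm.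
Qed.

Lemma QAutF_le_of_aut_invariant (T : pred (seq E)) :
  (forall s, s \in matroid_aut M -> forall A, T (map s A) = T A) ->
  qperm_le (QAutF M R) (qperm_tuples R T).
Proof.
move=> T_aut f Tf; apply/(CAut_eq_QAutF f).
by apply: perm_ideal_of_tuple_ideal Tf => s s_aut A _; apply: T_aut.
Qed.

Lemma QAutB_eq_QAutI : qperm_eq (QAutB M R) (QAutI M R).
Proof.
move=> f; split; apply: tuple_ideal_sub => A B tA tB sAB.
  move=> /andP[iA /eqP rA] nbB.
  apply: (tuple_ideal_pad R (C := [::])) => //; rewrite ?cats0 // => -[]// _.
  by rewrite cats0; move: nbB; rewrite /basis_tuple -sAB rA eqxx andbT.
move=> iA niB; have [C bAC] := indep_tuple_extend iA.
apply: (tuple_ideal_pad R (C := C)) => // [|D _].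
  by apply: uniq_in_Tup; case/andP: bAC => /andP[].
by apply: contra niB => /andP[/indep_tuple_catl].
Qed.

Lemma QAutC_le_QAutB : is_simple M -> matroid_rank M = 3 ->
  (forall F1 F2 F3 : {set E},
     is_triangle M F1 F2 F3 -> [set: E] <> F1 :|: F2 :|: F3) ->
  qperm_le (QAutC M R) (QAutB M R).
Proof.
move=> simple r3 no_cover f.
apply: tuple_ideal_sub => A B tA tB sAB bA nbB.
have sA : size A = 3 by case/andP: bA => _ /eqP; rewrite r3.
have sB : size B = 3 by rewrite -sAB.
have [uB|nuB] := boolP (uniq B).
  have cB := dependent_triple_circuit simple r3 sB uB nbB.
  have [] // := @tuple_ideal_pad R _ (circuit_tuple M) B A [::] (esym sAB).
  - by rewrite cats0.
  - by rewrite cats0.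
  by case=> // _; rewrite cats0 basis_tuple_not_circuit ?r3.
have [d cAd] := basis_circuit_extend simple r3 no_cover bA.
have sAd : size (A ++ [:: d]) = 4 by rewrite size_cat sA.
apply: (tuple_ideal_pad R (C := [:: d])) => // [|D sD].
  by apply: uniq_in_Tup; apply: circuit_tuple_uniq cAd _; rewrite sAd.
apply: contra nuB => /circuit_tuple_uniq.
by rewrite size_cat sB sD cat_uniq => /(_ isT) /andP[].
Qed.
End MatroidQuantumGroups.

Theorem mainTheorem1 (R : realType) (E : finType) (M : matroid E) :
  [/\ qperm_eq (CAut M R) (QAutF M R),
      qperm_le (QAutF M R) (QAutB M R) &
      qperm_eq (QAutB M R) (QAutI M R)] /\
  (is_simple M -> matroid_rank M = 3 ->
   (forall F1 F2 F3 : {set E},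
      is_triangle M F1 F2 F3 -> [set: E] <> F1 :|: F2 :|: F3) ->
   [/\ qperm_eq (CAut M R) (QAutF M R),
       qperm_le (QAutF M R) (QAutC M R),
       qperm_le (QAutC M R) (QAutB M R) &
       qperm_eq (QAutB M R) (QAutI M R)]).
Proof.
have FB : qperm_le (QAutF M R) (QAutB M R).
  by apply: QAutF_le_of_aut_invariant => s s_aut A; apply: basis_tuple_perm.
split; first by split; [apply: CAut_eq_QAutF | | apply: QAutB_eq_QAutI].
move=> simple r3 no_cover; split; [exact: CAut_eq_QAutF | | | ].
- by apply: QAutF_le_of_aut_invariant => s s_aut A; apply: circuit_tuple_perm.
- exact: QAutC_le_QAutB.
- exact: QAutB_eq_QAutI.
Qed.
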